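(* Let $\mathfrak o$ be a Dedekind domain (fields are not considered Dedekind domains). Let $\mathrm{SL}(2,\mathfrak o)^{\sharp}$ be the group of linear characters of $\mathrm{SL}(2,\mathfrak o)$ whose kernel is a congruence subgroup. Then $\mathrm{SL}(2,\mathfrak o)^{\sharp}$ equals the (internal) direct product $$\prod_{\mathfrak p}\langle\varepsilon_{\mathfrak p}\rangle\times\prod_{\mathfrak q\Vert 2}\langle\varepsilon_{\mathfrak q^2}\rangle\times\prod_{\mathfrak r^2\mid 2}\big(\langle\varepsilon_{\mathfrak r}\rangle\times\langle\varepsilon'_{\mathfrak r^2}\rangle\big),$$ where $\mathfrak p$ runs through all prime ideals of $\mathfrak o$ with $\mathfrak o/\mathfrak p\cong\mathbb F_3$, $\mathfrak q$ runs through all prime ideals with $\mathfrak o/\mathfrak q\cong\mathbb F_2$ such that $\mathfrak q^2$ does not divide $2$, and $\mathfrak r$ runs through all prime ideals with $\mathfrak o/\mathfrak r\cong\mathbb F_2$ such that $\mathfrak r^2$ divides $2$. Here $\langle\cdot\rangle$ denotes the cyclic subgroup generated by a character.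
   Context: Rings are commutative with $1$. A linear character of a group is a group homomorphism into the multiplicative group of complex numbers of modulus $1$; linear characters form a group under pointwise multiplication. An ideal $\mathfrak a$ divides $2$ if $2\in\mathfrak a$ (in particular if $2=0$ in $\mathfrak o$, every ideal divides $2$). $\mathbb F_p$ is the field with $p$ elements. Congruence subgroups: for a nonzero ideal $\mathfrak l$ of $\mathfrak o$ let $\Gamma(\mathfrak l)$ be the kernel of the natural map $\mathrm{SL}(2,\mathfrak o)\to\mathrm{SL}(2,\mathfrak o/\mathfrak l)$. A subgroup of $\mathrm{SL}(2,\mathfrak o)$ is a congruence subgroup if it contains $\Gamma(\mathfrak l)$ for some nonzero ideal $\mathfrak l$. The characters $\varepsilon_N$: for $N\in\{2,3,4\}$ let $G_N=\mathrm{SL}(2,\mathbb Z/N\mathbb Z)$, and let $\mathrm t(A)$ denote the trace of $A$. For $A=\begin{bmatrix}*&b\\c&*\end{bmatrix}\in G_N$ define $\{A\}_N\in\mathbb Z/N\mathbb Z$ by: $\{A\}_N=0$ if $A=\pm1$, or if $N=4$ and $A\equiv 1\bmod 2$; $\{A\}_N=1$ if $\mathrm t(A)^2\neq 4$ in $\mathbb Z/N\mathbb Z$; and in all other cases $\{A\}_N=c$ if $c$ is a unit of $\mathbb Z/N\mathbb Z$ and $\{A\}_N=-b$ otherwise. For $A\in G_4$ put $s(A)=-1$ if $A$ can be written as $1+2\begin{bmatrix}a&b\\c&*\end{bmatrix}$ with $a+b+c$ odd, and $s(A)=1$ otherwise. The linear characters $\varepsilon_N$ of $G_N$ are $$\varepsilon_2(A)=e^{\frac{2\pi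 i}{2}(\mathrm t(A)+1)\{A\}_2},\quad \varepsilon_3(A)=e^{\frac{2\pi i}{3}\mathrm t(A)\{A\}_3},\quad \varepsilon_4(A)=s(A)\,e^{\frac{2\pi i}{4}(\mathrm t(A)+1)\{A\}_4}.$$ If $\mathfrak l$ is an ideal of $\mathfrak o$ with $\mathfrak o/\mathfrak l\cong\mathbb Z/N\mathbb Z$, $N\in\{2,3,4\}$, then $\varepsilon_{\mathfrak l}:=\varepsilon_N\circ\mathrm{red}_{\mathfrak l}$, where $\mathrm{red}_{\mathfrak l}:\mathrm{SL}(2,\mathfrak o)\to G_N$ is reduction of entries modulo $\mathfrak l$ followed by the unique ring isomorphism $\mathfrak o/\mathfrak l\cong\mathbb Z/N\mathbb Z$. (If $\mathfrak q$ is a prime ideal with $\mathfrak o/\mathfrak q\cong\mathbb F_2$ and $\mathfrak q^2\nmid2$, then $\mathfrak o/\mathfrak q^2\cong\mathbb Z/4\mathbb Z$.) The character $\varepsilon_4'$: let $R=\mathbb F_2[t]/(t^2)$ and $\alpha=t+(t^2)$. Every $A\in\mathrm{SL}(2,R)$ can be written uniquely as $A=A_0(1+\alpha B)$ with $A_0\in\mathrm{SL}(2,\mathbb F_2)$ and $B$ a $2\times2$ matrix over $\mathbb F_2$ of trace $0$. The linear character $\varepsilon_4'$ of $\mathrm{SL}(2,R)$ is defined by $\varepsilon_4'(A)=(-1)^{a+b+c}$ if $B=\begin{bmatrix}a&b\\c&*\end{bmatrix}$. If $\mathfrak l$ is an ideal of $\mathfrak o$ with $\mathfrak o/\mathfrak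 l\cong R$, then $\varepsilon'_{\mathfrak l}:=\varepsilon_4'\circ\mathrm{red}_{\mathfrak l}$, where $\mathrm{red}_{\mathfrak l}:\mathrm{SL}(2,\mathfrak o)\to\mathrm{SL}(2,R)$ is reduction of entries modulo $\mathfrak l$ followed by the unique ring isomorphism $\mathfrak o/\mathfrak l\cong R$. (If $\mathfrak r$ is a prime ideal with $\mathfrak o/\mathfrak r\cong\mathbb F_2$ and $\mathfrak r^2\mid2$, then $\mathfrak o/\mathfrak r^2\cong R$.) *)

(* Defs.v *)
From HB Require Import structures.
From mathcomp Require Import all_boot all_order all_algebra.
From mathcomp Require Import generic_quotient ring_quotient fraction qpoly.
From mathcomp Require Import boolp classical_sets functions cardinality fsbigop.
From mathcomp Require Import reals trigo.
From mathcomp Require Import complex.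

Set Implicit Arguments.
Unset Strict Implicit.
Unset Printing Implicit Defensive.

Import Order.TTheory GRing.Theory Num.Theory.
Local Open Scope quotient_scope.
Local Open Scope classical_set_scope.
Local Open Scope ring_scope.

(* Ideals are boolean predicates; since propositions are decidable (boolp),   *)
(* every ideal is of this form. [idealr] and [idealr_closed] (ring_quotient)  *)
(* exclude the unit ideal, [ideal_closed] does not.                           *)
Definition ideal_closed (A : comNzRingType) (I : {pred A}) : Prop :=
  0 \in I /\ forall a, {in I &, forall u v, a * u + v \in I}.

Definition finitely_generated (A : comNzRingType) (I : {pred A}) : Prop :=
  exists s : seq A, forall x,
    x \in I <-> exists c : A ^ (size s), x = \sum_(i < size s) c i * s`_i.

Definition ideal_mul (A : comNzRingType) (I J : {pred A}) : {pred A} :=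
  fun x => `[< exists s : seq (A * A),
    {in s, forall uv, uv.1 \in I /\ uv.2 \in J} /\
    x = \sum_(uv <- s) uv.1 * uv.2 >].

Lemma ideal_mul_idealr_closed (A : comNzRingType) (I J : idealr A) :
  idealr_closed (ideal_mul I J).
Proof.
split.
- by apply/asboolP; exists [::]; split=> //; rewrite big_nil.
- apply/negP => /asboolP[s [sIJ e]]; move: (idealr1 I); rewrite e.
  rewrite big_seq rpred_sum // => uv /sIJ[uI _].
  by rewrite mulrC idealMr.
- move=> a x y /asboolP[s [sIJ ->]] /asboolP[t [tIJ ->]]; apply/asboolP.
  exists ([seq (a * uv.1, uv.2) | uv <- s] ++ t); split.
    move=> uv; rewrite mem_cat => /orP[/mapP[w /sIJ[w1 w2] ->]|/tIJ //].
    by split=> //=; rewrite idealMr.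
  rewrite big_cat big_map mulr_sumr; congr (_ + _).
  by apply: eq_bigr => uv _; rewrite mulrA.
Qed.

HB.instance Definition _ (A : comNzRingType) (I J : idealr A) :=
  isIdealr.Build A (ideal_mul I J) (ideal_mul_idealr_closed I J).

(* [prime_idealr A] lives in too large a universe to index a family, whence   *)
(* this record.                                                               *)
Record prime_ideal (A : comNzRingType) := PrimeIdeal {
  prime_ideal_val : A -> bool;
  prime_ideal_closed : idealr_closed prime_ideal_val;
  prime_idealP : prime_idealr_closed prime_ideal_val
}.

HB.instance Definition _ (A : comNzRingType) (p : prime_ideal A) :=
  isIdealr.Build A (prime_ideal_val p) (prime_ideal_closed p).
HB.instance Definition _ (A : comNzRingType) (p : prime_ideal A) :=
  isPrimeIdealrClosed.Build A (prime_ideal_val p) (@prime_idealP A p).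
Definition prime_idealr_of (A : comNzRingType) (p : prime_ideal A)
  : prime_idealr A := PrimeIdealr.clone A (prime_ideal_val p) _.
Coercion prime_idealr_of : prime_ideal >-> PrimeIdealr.type.

Definition ideal_divides (A : comNzRingType) (I : {pred A}) (a : A) : Prop :=
  a \in I.

Definition maximal_ideal (A : comNzRingType) (p : idealr A) : Prop :=
  forall I : idealr A, {subset p <= I} -> {subset I <= p}.

Record dedekind_domain (o : idomainType) : Prop := DedekindDomain {
  dedekind_not_field : ~ (forall x : o, x != 0 -> x \is a GRing.unit);
  dedekind_noetherian :
    forall I : {pred o}, ideal_closed I -> finitely_generated I;
  dedekind_integrally_closed :
    forall z : {fraction o}, integralOver (@tofrac o) z ->
      exists x : o, z = tofrac x;
  dedekind_dim1 :
    forall p : prime_ideal o,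
      (exists2 x : o, x != 0 & x \in p) -> maximal_ideal p
}.

Definition ring_isomorphic (A B : nzRingType) : Prop :=
  exists f : {rmorphism A -> B}, bijective f.

Section SL2.
Variable A : comNzRingType.

Record SL2 := MkSL2 { SL2_val :> 'M[A]_2; _ : \det SL2_val == 1 }.
HB.instance Definition _ := [isSub for SL2_val].
HB.instance Definition _ := [Choice of SL2 by <:].

Implicit Types M N : SL2.

Lemma det_SL2 M : \det M = 1. Proof. by apply/eqP; case: M. Qed.

Fact SL2_one_subproof : \det (1%:M : 'M[A]_2) == 1.
Proof. by rewrite det1. Qed.
Definition SL2_one := MkSL2 SL2_one_subproof.

Fact SL2_mul_subproof M N : \det (M *m N) == 1.
Proof. by rewrite det_mulmx !det_SL2 mulr1. Qed.
Definition SL2_mul M N := MkSL2 (SL2_mul_subproof M N).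

Fact SL2_inv_subproof M : \det (\adj M) == 1.
Proof.
have := det_mulmx M (\adj M).
by rewrite mul_mx_adj det_SL2 det1 mul1r => <-.
Qed.
Definition SL2_inv M := MkSL2 (SL2_inv_subproof M).

Fact SL2_mulA : associative SL2_mul.
Proof. by move=> x y z; apply: val_inj; rewrite /= mulmxA. Qed.
Fact SL2_mul1 : left_id SL2_one SL2_mul.
Proof. by move=> x; apply: val_inj; rewrite /= mul1mx. Qed.
Fact SL2_mulx1 : right_id SL2_one SL2_mul.
Proof. by move=> x; apply: val_inj; rewrite /= mulmx1. Qed.
Fact SL2_mulV : left_inverse SL2_one SL2_inv SL2_mul.
Proof. by move=> x; apply: val_inj; rewrite /= mul_adj_mx det_SL2. Qed.
Fact SL2_mulxV : right_inverse SL2_one SL2_inv SL2_mul.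
Proof. by move=> x; apply: val_inj; rewrite /= mul_mx_adj det_SL2. Qed.

HB.instance Definition _ :=
  isGroup.Build SL2 SL2_mulA SL2_mul1 SL2_mulx1 SL2_mulV SL2_mulxV.

End SL2.

Fact SL2_map_subproof (A B : comNzRingType) (f : {rmorphism A -> B})
  (M : SL2 A) : \det (map_mx f M) == 1.
Proof. by rewrite det_map_mx det_SL2 rmorph1. Qed.

Definition SL2_map (A B : comNzRingType) (f : {rmorphism A -> B}) (M : SL2 A)
  : SL2 B := MkSL2 (SL2_map_subproof f M).

Definition subgroup (G : groupType) (H : set G) : Prop :=
  H 1%g /\ forall x y, H x -> H y -> H (x * y^-1)%g.

(* The kernel of SL(2,A) -> SL(2,A/I), described entrywise so as to allow for *)
(* the unit ideal.                                                            *)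
Definition principal_congruence (A : comNzRingType) (I : {pred A})
  : set (SL2 A) :=
  [set M : SL2 A | forall i j, M i j - (1%:M : 'M[A]_2) i j \in I].

Definition congruence_subgroup (A : comNzRingType) (H : set (SL2 A)) : Prop :=
  subgroup H /\
  exists I : {pred A}, [/\ ideal_closed I, exists2 x, x != 0 & x \in I &
    principal_congruence I `<=` H].

(* Characters, and more generally maps to the complex numbers R[i], are       *)
(* multiplied pointwise, i.e. in the ring of functions G -> R[i].             *)
Definition linear_character (R : realType) (G : groupType) (chi : G -> R[i])
  : Prop :=
  (forall x, `|chi x| = 1) /\ (forall x y, chi (x * y)%g = chi x * chi y).

Definition SL2_sharp (R : realType) (o : idomainType) : set (SL2 o -> R[i]) :=
  [set chi | linear_character chi /\
             congruence_subgroup [set M | chi M = 1]].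

Arguments SL2_sharp R o : clear implicits.

Definition cyclic_subgroup (R : realType) (G : groupType) (chi : G -> R[i])
  : set (G -> R[i]) :=
  [set psi | exists n : int, psi = (fun x => chi x ^ n)].

(* Families over an infinite index set are multiplied with finite support     *)
(* (restricted direct product).                                               *)
Definition internal_direct_product (C : comPzRingType) (I : choiceType)
    (G : set C) (H : I -> set C) : Prop :=
  let factors h :=
    (forall i, H i (h i)) /\ finite_set [set i | h i <> 1] in
  let prod (h : I -> C) := \big[*%R/1]_(i \in [set: I]) h i in
  (forall h, factors h -> G (prod h)) /\
  (forall g, G g -> exists! h : I -> C, factors h /\ prod h = g).

(* exp(2 pi i k / N), for k an integer modulo N *)
Definition e_mod (R : realType) (N : nat) (k : 'Z_N) : R[i] :=
  let x : R := 2 * pi * (k : nat)%:R / N%:R in (cos x +i* sin x)%C.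

Definition brace (N : nat) (M : 'M['Z_N]_2) : 'Z_N :=
  let b := M 0 1 in let c := M 1 0 in
  if [|| M == 1, M == -1 |
         (N == 4%N) && [exists B : 'M['Z_N]_2, M == 1 + 2 *: B]] then 0
  else if (\tr M) ^+ 2 != 4 then 1
  else if c \is a GRing.unit then c
  else - b.

Arguments e_mod R N k : clear implicits.
Arguments brace N M : clear implicits.

Definition s_sign (R : realType) (M : 'M['Z_4]_2) : R[i] :=
  if [exists B : 'M['Z_4]_2,
       (M == 1 + 2 *: B) && odd (B 0 0 + B 0 1 + B 1 0 : 'Z_4)%R]
  then -1 else 1.

Definition eps2 (R : realType) (M : SL2 'Z_2) : R[i] :=
  e_mod R 2 ((\tr M + 1) * brace 2 M).

Definition eps3 (R : realType) (M : SL2 'Z_3) : R[i] :=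
  e_mod R 3 (\tr M * brace 3 M).

Definition eps4 (R : realType) (M : SL2 'Z_4) : R[i] :=
  s_sign R M * e_mod R 4 ((\tr M + 1) * brace 4 M).

Definition F2t2 : comNzRingType := {poly %/ ('X^2 : {poly 'F_2})}.
Definition alpha : F2t2 := qpolyX ('X^2 : {poly 'F_2}).

Definition lift_F2t2 (M : 'M['F_2]_2) : 'M[F2t2]_2 :=
  \matrix_(i, j) qpolyC ('X^2 : {poly 'F_2}) (M i j).

(* The decomposition exists and is unique, so the choice made by [pick] is    *)
(* forced and the [None] branch is never taken.                               *)
Definition eps4' (R : realType) (M : SL2 F2t2) : R[i] :=
  if [pick B : 'M['F_2]_2 | (\tr B == 0) &&
       [exists M0 : 'M['F_2]_2, (\det M0 == 1) &&
          ((M : 'M[F2t2]_2) ==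
             lift_F2t2 M0 *m (1%:M + alpha *: lift_F2t2 B))]]
  is Some B then (-1) ^+ (B 0 0 + B 0 1 + B 1 0 : 'F_2)%R else 1.

Definition quot_map (A : comNzRingType) (I : idealr A)
  : {rmorphism A -> {ideal_quot I}} :=
  GRing.RMorphism.clone A {ideal_quot I} \pi_{ideal_quot I} _.

(* The character eps \o red_I attached to an ideal I with o/I isomorphic to   *)
(* B; it does not depend on the isomorphism when B has no automorphism but    *)
(* the identity. If o/I and B are not isomorphic the value is the zero map,   *)
(* which is not a character.                                                  *)
Definition pullback (R : realType) (o : idomainType) (B : comNzRingType)
    (eps : SL2 B -> R[i]) (I : idealr o) : SL2 o -> R[i] :=
  match pselect (ring_isomorphic {ideal_quot I} B) with
  | left isoIB =>
      fun M => eps (SL2_map (sval (cid isoIB)) (SL2_map (quot_map I) M))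
  | right _ => fun=> 0
  end.

Definition ideal_sq (A : comNzRingType) (I : idealr A) : idealr A :=
  ideal_mul I I.

Variant factor_index (o : idomainType) : Type :=
  | FactorP (p : prime_ideal o) of ring_isomorphic {ideal_quot p} 'F_3
  | FactorQ (q : prime_ideal o) of ring_isomorphic {ideal_quot q} 'F_2
      & ~ ideal_divides (ideal_sq q) 2
  | FactorR (r : prime_ideal o) of ring_isomorphic {ideal_quot r} 'F_2
      & ideal_divides (ideal_sq r) 2
  | FactorR' (r : prime_ideal o) of ring_isomorphic {ideal_quot r} 'F_2
      & ideal_divides (ideal_sq r) 2.

Definition factor_character (R : realType) (o : idomainType)
    (i : factor_index o) : SL2 o -> R[i] :=
  match i with
  | FactorP p _ => pullback (@eps3 R) p
  | FactorQ q _ _ => pullback (@eps4 R) (ideal_sq q)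
  | FactorR r _ _ => pullback (@eps2 R) r
  | FactorR' r _ _ => pullback (@eps4' R) (ideal_sq r)
  end.

(* Main.v *)
(* A character chi of SL(2,o) that is trivial on Gamma(l) is determined by the
   additive character psi x = chi [1 x; 0 1] of o: modulo l every matrix is a
   product of elementary ones (stable range), and lower unitriangular matrices
   are conjugate to upper ones. Conjugation by diag(u, 1/u) shows that
   psi ((u^2 - 1) x) = 1 for every u invertible modulo l. Splitting psi along
   the idempotents e_p of o/l gives local characters psi (e_p x) trivial on
   the ideal generated by the u^2 - 1 with u not in p. That ideal is locally
   everything if |o/p| > 3, contains p if |o/p| = 3, and, if |o/p| = 2,
   contains r^2 when r^2 divides 2 and q^3 otherwise; in the last case one
   uses moreover diag(u, u)^2 = 1 for u = 1 - 2 e_p, whence psi (12 e_p) = 1.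
   So psi is a product of characters of o/p, o/q^2 and o/r^2, which are the
   psi of the characters listed. Independence is the Chinese remainder theorem. *)

Require Import Defs.
From HB Require Import structures.
From mathcomp Require Import all_boot all_order all_algebra ring.
From mathcomp Require Import generic_quotient ring_quotient fraction qpoly.
From mathcomp Require Import boolp classical_sets functions cardinality fsbigop.
From mathcomp Require Import reals trigo.
From mathcomp Require Import complex.

Set Implicit Arguments.
Unset Strict Implicit.
Unset Printing Implicit Defensive.

Import Order.TTheory GRing.Theory Num.Theory.
Local Open Scope ring_scope.

(** * Ideals of a Dedekind domain *)

(** The square relation alone is too weak at a prime q with residue field F_2 and 2 outside q^2:
    every unit of Z/8 has square 1, so a character of order 8 would survive it. The number 12 comes
    from writing diag(u, 1/u) as a product of elementary matrices, whose exponents add up to 2u +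
    1/u - 3. For an involution u this is 3u - 3, and squaring the matrix gives 6u - 6, which is -12
    e_p for u = 1 - 2 e_p. Since 8 e_p is already in the kernel of psi, so is 4 e_p. In the proof of
    independence the Chinese remainder theorem leaves one case open: the two characters attached to
    the same prime r with r^2 dividing 2. Their additive characters differ at 1, with value -1 for
    the one modulo r and 1 for the one modulo r^2. The arithmetic of o enters through two facts:
    every nonzero ideal contains a product of nonzero primes, which produces the idempotents, and
    integral closure supplies a uniformizer at each nonzero prime, which determines o/p^2 when the
    residue field is F_2. That the listed maps are homomorphisms is a finite computation. *)

Section IdealClosed.
Variables (A : comNzRingType) (I : {pred A}) (hI : ideal_closed I).

Lemma ideal_closed0 : 0 \in I. Proof. by case: hI. Qed.

Lemma ideal_closedM a u : u \in I -> a * u \in I.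
Proof. by move=> uI; rewrite -[a * u]addr0; apply: hI.2 => //; case: hI. Qed.

Lemma ideal_closedMr a u : u \in I -> u * a \in I.
Proof. by rewrite mulrC; apply: ideal_closedM. Qed.

Lemma ideal_closedD u v : u \in I -> v \in I -> u + v \in I.
Proof. by move=> uI vI; rewrite -[u]mul1r; apply: hI.2. Qed.

Lemma ideal_closedN u : u \in I -> - u \in I.
Proof. by rewrite -mulN1r; apply: ideal_closedM. Qed.

Lemma ideal_closedB u v : u \in I -> v \in I -> u - v \in I.
Proof. by move=> uI /ideal_closedN; apply: ideal_closedD. Qed.

Lemma ideal_closed_sum (J : eqType) (r : seq J) (P : pred J) F :
  (forall i, i \in r -> P i -> F i \in I) -> \sum_(i <- r | P i) F i \in I.
Proof.
move=> h; rewrite big_seq_cond; elim/big_ind: _ => [||i /andP[]].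
- exact: ideal_closed0.
- exact: ideal_closedD.
- exact: h.
Qed.

Definition ideal_adjoin (a : A) : {pred A} :=
  fun x => `[< exists u b, u \in I /\ x = u + b * a >].

Lemma ideal_adjoinP a x :
  reflect (exists u b, u \in I /\ x = u + b * a) (x \in ideal_adjoin a).
Proof. exact: asboolP. Qed.

Lemma ideal_adjoin_closed a : ideal_closed (ideal_adjoin a).
Proof.
split; first by apply/ideal_adjoinP; exists 0, 0; split; [exact: ideal_closed0|ring].
move=> c x y /ideal_adjoinP[u [b [uI ->]]] /ideal_adjoinP[v [d [vI ->]]].
apply/ideal_adjoinP; exists (c * u + v), (c * b + d); split; last by ring.
exact: hI.2.
Qed.

Lemma sub_ideal_adjoin a : {subset I <= ideal_adjoin a}.
Proof. by move=> u uI; apply/ideal_adjoinP; exists u, 0; split=> //; ring. Qed.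

Lemma mem_ideal_adjoin a : a \in ideal_adjoin a.
Proof.
by apply/ideal_adjoinP; exists 0, 1; split; [exact: ideal_closed0|ring].
Qed.

End IdealClosed.

Lemma idealr_ideal_closed (A : comNzRingType) (I : idealr A) :
  ideal_closed (I : {pred A}).
Proof.
by split=> [|a u v uI vI]; [exact: idealr0|rewrite rpredD // idealMr].
Qed.

Lemma zero_ideal_closed (A : comNzRingType) : ideal_closed (pred1 (0 : A)).
Proof.
by split=> [|a u v /eqP-> /eqP->]; rewrite inE // mulr0 addr0.
Qed.

Section Noetherian.
Variable A : comNzRingType.
Hypothesis noeth :
  forall I : {pred A}, ideal_closed I -> finitely_generated I.

(** If [P] failed somewhere, dependent choice would give a strictly increasing chain of ideals. Its
    union is finitely generated, so all generators already lie in one member of the chain, which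
    then cannot grow. *)
Lemma noetherian_ind (P : {pred A} -> Prop) :
  (forall I, ideal_closed I ->
     (forall J, ideal_closed J -> {subset I <= J} ->
        (exists2 x, x \in J & x \notin I) -> P J) -> P I) ->
  forall I, ideal_closed I -> P I.
Proof.
move=> ind I0 hI0; apply: contrapT => nP0.
pose F := {I : {pred A} | ideal_closed I /\ ~ P I}.
have step (I : F) : exists J : F, {subset sval I <= sval J} /\
    exists2 x, x \in sval J & x \notin sval I.
  case: I => I [hI nPI] /=; apply: contrapT => no; apply: nPI.
  apply: ind => // J hJ IJ xJ; apply: contrapT => nPJ; apply: no.
  by exists (exist _ J (conj hJ nPJ)).
pose next I := sval (cid (step I)).
have nextP I : {subset sval I <= sval (next I)} /\
    exists2 x, x \in sval (next I) & x \notin sval I.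
  by rewrite /next; case: cid.
pose c n := iter n next (exist _ I0 (conj hI0 nP0)).
have cS n m : (n <= m)%N -> {subset sval (c n) <= sval (c m)}.
  elim: m => [|m IH]; first by rewrite leqn0 => /eqP->.
  rewrite leq_eqVlt => /predU1P[-> //|nm] x xn.
  by apply: (nextP (c m)).1; apply: IH.
pose U : {pred A} := fun x => `[< exists n, x \in sval (c n) >].
have UP x : reflect (exists n, x \in sval (c n)) (x \in U) by exact: asboolP.
have cI n : ideal_closed (sval (c n)) by case: (c n) => I [].
have hU : ideal_closed U.
  split; first by apply/UP; exists 0%N; apply: ideal_closed0.
  move=> a u v /UP[n un] /UP[m vm]; apply/UP; exists (maxn n m).
  apply: (cI _).2; first exact: cS (leq_maxl _ _) _ un.
  exact: cS (leq_maxr _ _) _ vm.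
have [s sP] := noeth hU.
have [m sm] : exists m, {subset s <= sval (c m)}.
  have {}sP : {subset s <= U}.
    move=> x xs; apply/sP.
    exists [ffun i : 'I_(size s) => ((i : nat) == index x s)%:R].
    rewrite (bigD1 (Ordinal (etrans (index_mem x s) xs))) //= ffunE eqxx mul1r.
    rewrite nth_index // big1 ?addr0 // => i ne; rewrite ffunE.
    by rewrite -val_eqE /= in ne; rewrite (negbTE ne) mul0r.
  elim: s sP => [|x s IH] sP; first by exists 0%N.
  have [m sm] := IH (fun y ys => sP y (mem_behead (s := x :: s) ys)).
  have /UP[n xn] := sP x (mem_head _ _).
  exists (maxn n m) => y; rewrite inE => /predU1P[->|/sm].
    exact: cS (leq_maxl _ _) _ xn.
  by apply: cS; exact: leq_maxr.
have [_ [x xm1 /negP[]]] := nextP (c m).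
have /sP[k ->] : x \in U by apply/UP; exists m.+1.
apply: ideal_closed_sum => // i _ _; apply: ideal_closedM => //.
by apply: sm; apply: mem_nth.
Qed.

End Noetherian.

HB.instance Definition _ (A : comNzRingType) := gen_eqMixin (prime_ideal A).
HB.instance Definition _ (A : comNzRingType) := gen_choiceMixin (prime_ideal A).

Section PrimeIdealMembership.
Variables (A : comNzRingType) (p : prime_ideal A).
Implicit Types x y : A.

Lemma prime_closed : ideal_closed (p : {pred A}).
Proof. exact: idealr_ideal_closed. Qed.

Lemma prime_ideal1 : (1 : A) \in p = false.
Proof. exact: idealr1. Qed.

Lemma prime_ideal0 : (0 : A) \in p.
Proof. exact: idealr0. Qed.

Lemma prime_idealD x y : x \in p -> y \in p -> x + y \in p.
Proof. exact: ideal_closedD prime_closed _ _. Qed.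

Lemma prime_idealB x y : x \in p -> y \in p -> x - y \in p.
Proof. exact: ideal_closedB prime_closed _ _. Qed.

Lemma prime_idealMl x y : y \in p -> x * y \in p.
Proof. exact: ideal_closedM prime_closed _ _. Qed.

Lemma prime_idealMr x y : x \in p -> x * y \in p.
Proof. exact: ideal_closedMr prime_closed _ _. Qed.

Lemma prime_idealM x y : (x * y \in p) = (x \in p) || (y \in p).
Proof. exact: prime_idealrM. Qed.

End PrimeIdealMembership.

Section Dedekind.
Variables (o : idomainType) (ho : dedekind_domain o).
Implicit Types (p q : prime_ideal o) (I : {pred o}) (x y : o).

Definition nonzero_ideal I : Prop := exists2 x, x != 0 & x \in I.

Lemma prime_ideal_eq p q : p =i q -> p = q.
Proof.
case: p q => [p hp pp] [q hq pq] pqE.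
have {}pqE : p = q by apply/funext => x; exact: pqE.
by subst q; congr PrimeIdeal; exact: Prop_irrelevance.
Qed.

(** Nonzero primes are maximal, and p + (x) is strictly larger than p, hence contains 1. *)
Lemma prime_ideal_invertible p x :
  nonzero_ideal p -> x \notin p -> exists y, 1 - x * y \in p.
Proof.
move=> p0 xp; apply: contrapT => no.
have hp := prime_closed p.
pose J := ideal_adjoin p x.
have hJ : idealr_closed J.
  split; first exact: ideal_closed0 (ideal_adjoin_closed hp x).
    apply/negP => /ideal_adjoinP[u [b [up e]]]; apply: no; exists b.
    by rewrite e mulrC addrK.
  by move=> a; exact: (ideal_adjoin_closed hp x).2.
pose K := HB.pack_for (idealr o) J (isIdealr.Build o J hJ).
have /(_ x) := @dedekind_dim1 _ ho p p0 K (@sub_ideal_adjoin _ p x).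
by rewrite (negbTE xp) => /(_ (mem_ideal_adjoin hp x)).
Qed.

Lemma prime_ideal_separated p q :
  nonzero_ideal p -> nonzero_ideal q -> p <> q ->
  exists2 g : o, g \in q & g \notin p.
Proof.
move=> p0 q0 pq; apply: contrapT => no; apply: pq; apply: prime_ideal_eq.
have qp : {subset q <= p}.
  by move=> x xq; apply: contrapT => xp; apply: no; exists x => //; apply/negP.
by move=> x; apply/idP/idP; [exact: (dedekind_dim1 ho q0 qp)|exact: qp].
Qed.

Lemma prime_ideal_crt p (t : seq (prime_ideal o)) :
  nonzero_ideal p ->
  (forall q, q \in t -> nonzero_ideal q) ->
  exists f, 1 - f \in p /\
    (forall q : prime_ideal o, q \in t ->
       q <> p -> f \in q).
Proof.
move=> p0; elim: t => [|q t IH] t0.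
  by exists 1; split => //; rewrite subrr prime_ideal0.
have [r rt|f [fp ft]] := IH; first by apply: t0; rewrite inE rt orbT.
have [->|qp] := pselect (q = p).
  by exists f; split=> // r; rewrite inE => /predU1P[-> //|]; exact: ft.
have [g gq gp] : exists2 g : o, g \in q & g \notin p.
  by apply: prime_ideal_separated => //; [exact: t0 (mem_head _ _)|exact: nesym].
have [y gy] := prime_ideal_invertible p0 gp.
exists (f * (g * y)); split.
  have -> : 1 - f * (g * y) = (1 - f) + f * (1 - g * y) by ring.
  by rewrite prime_idealD // prime_idealMl.
move=> r rqt rp; move: rqt; rewrite in_cons => /predU1P[->|rt].
  by rewrite (_ : f * (g * y) = f * y * g) ?prime_idealMl //; ring.
by rewrite prime_idealMr // ft.
Qed.

(** Noetherian induction: if a * b is in [I] but a and b are not, then the product of I + (a) and I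
    + (b) lies in [I]. Choosing one element from each prime of the list stands for the product of
    these primes, counted with multiplicity. *)
Lemma prime_product I : ideal_closed I -> nonzero_ideal I ->
  exists s : seq (prime_ideal o),
    (forall q : prime_ideal o,
       q \in s -> nonzero_ideal q) /\
    forall xs : seq o,
      all2 (fun (q : prime_ideal o) x => x \in q) s xs ->
      \prod_(x <- xs) x \in I.
Proof.
move: I; refine (noetherian_ind (dedekind_noetherian ho) _) => I hI IH I0.
have [I1|I1] := boolP (1 \in I).
  by exists [::]; split=> // -[|//] _; rewrite big_nil.
have [prI|] := pselect (prime_idealr_closed I).
  have hI' : idealr_closed I.
    by split=> //; [exact: ideal_closed0|exact: hI.2].
  exists [:: PrimeIdeal hI' prI]; split.
    by move=> q; rewrite inE => /eqP ->.
  move=> [//|x [|y xs]] /=; rewrite ?andbF // andbT => xI.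
  by rewrite big_seq1.
move=> /existsNP[a /existsNP[b nab]].
have {nab}[abI aI bI] : [/\ a * b \in I, a \notin I & b \notin I].
  by split; apply: contrapT => h; apply: nab => abI;
     move: h; rewrite ?abI //; case: (a \in I) (b \in I) => [] [].
have [x x0 xI] := I0.
have adj c : c \notin I ->
    exists s : seq (prime_ideal o),
    (forall q : prime_ideal o,
       q \in s -> nonzero_ideal q) /\
    forall xs : seq o,
      all2 (fun (q : prime_ideal o) x => x \in q) s xs ->
      \prod_(x <- xs) x \in ideal_adjoin I c.
  move=> cI; apply: IH.
  - exact: ideal_adjoin_closed.
  - exact: sub_ideal_adjoin.
  - by exists c => //; exact: mem_ideal_adjoin.
  - by exists x => //; exact: sub_ideal_adjoin.
have [s [s0 sP]] := adj a aI; have [t [t0 tP]] := adj b bI.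
exists (s ++ t); split.
  by move=> q; rewrite mem_cat => /orP[/s0|/t0].
move=> xs; rewrite all2E size_cat => /andP[/eqP sz].
rewrite -[xs](cat_take_drop (size s)) zip_cat; last first.
  by rewrite size_takel // -sz leq_addr.
rewrite all_cat => /andP[h1 h2]; rewrite big_cat /=.
have /ideal_adjoinP[u [k [uI ->]]] : \prod_(x <- take (size s) xs) x \in ideal_adjoin I a.
  by apply: sP; rewrite all2E h1 size_takel ?eqxx // -sz leq_addr.
have /ideal_adjoinP[v [m [vI ->]]] : \prod_(x <- drop (size s) xs) x \in ideal_adjoin I b.
  by apply: tP; rewrite all2E h2 size_drop -sz addKn eqxx.
have -> : (u + k * a) * (v + m * b) = (v + m * b) * u + (k * a) * v + (k * m) * (a * b).
  by ring.
by do 2?apply: ideal_closedD => //; apply: ideal_closedM.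
Qed.

Lemma exp_nseq_prod y n : \prod_(x <- nseq n y) x = y ^+ n.
Proof. by elim: n => [|n IH]; rewrite /= ?big_nil // big_cons IH exprS. Qed.

Lemma subr1_expl (A : comNzRingType) (z : A) n :
  exists h, 1 - (1 - z) ^+ n = z * h.
Proof.
elim: n => [|n [h e]]; first by exists 0; ring.
by exists (h + (1 - z) ^+ n); rewrite mulrDr -e exprS; ring.
Qed.

Lemma subr1_exp (A : comNzRingType) (z : A) n :
  exists h, 1 - z ^+ n = (1 - z) * h.
Proof. by have [h] := subr1_expl (1 - z) n; rewrite subKr => e; exists h. Qed.

(* The quotient of [o] by a nonzero ideal is a finite product of local rings; *)
(* [e p] is the idempotent of the factor whose maximal ideal is [p].          *)
Lemma local_idempotents I : ideal_closed I -> nonzero_ideal I ->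
  exists (s : seq (prime_ideal o)) (e : prime_ideal o -> o),
  [/\ uniq s,
      forall p, p \in s ->
        nonzero_ideal p /\ e p * e p - e p \in I,
      forall p q, p \in s ->
        q \in s -> p <> q -> e p * e q \in I,
      1 - \sum_(p <- s) e p \in I
    & forall p x, p \in s -> x \notin p ->
        exists y, e p * (1 - x * y) \in I].
Proof.
move=> hI I0; have [s0 [s0P s0I]] := prime_product hI I0.
set n := size s0; pose s := undup s0.
have sE p : (p \in s) =
  (p \in s0) by exact: mem_undup.
(* The number [n] counts the primes of [s0] with multiplicity, so y ^+ n supplies one factor for
   each entry of [s0]. *)
have nil y : (forall p, p \in s -> y \in p) ->
    y ^+ n \in I.
  move=> h; rewrite -exp_nseq_prod; apply: s0I.
  have {h} : forall p, p \in s0 -> y \in p.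
    by move=> p; rewrite -sE; exact: h.
  rewrite /n; elim: (s0) => //= p t IH h.
  by rewrite (h p (mem_head _ _)) IH // => q qt; apply: h; rewrite inE qt orbT.
have exf p : exists f, p \in s ->
   1 - f \in p /\ (forall q : prime_ideal o, q \in s ->
       q <> p -> f \in q).
  have [ps|ps] := pselect (p \in s); last by exists 0.
  have p0 : nonzero_ideal p by apply: s0P; rewrite -sE.
  have [q qs|f fP] := @prime_ideal_crt p s p0; last by exists f.
  by apply: s0P; rewrite -sE.
have [f fP] := choice exf.
(* The polynomial 1 - (1 - X^n)^n is divisible by X^n, and 1 minus it by (1 - X)^n. So e p lies deep
   in all other primes and 1 - e p deep in p, and e p * (1 - e p) is a multiple of the n-th power of
   f p * (1 - f p), an element of every prime of [s]. *)
pose e p : o := 1 - (1 - f p ^+ n) ^+ n.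
have eE p : exists h, e p = f p ^+ n * h by exact: subr1_expl.
have ortho p q : p \in s ->
        q \in s -> p <> q -> e p * e q \in I.
  move=> ps qs pq; have [h ->] := eE p; have [k ->] := eE q.
  rewrite mulrACA -exprMn mulrC; apply: ideal_closedM => //; apply: nil => r rs.
  have [rp|rp] := pselect (r = p).
    by rewrite prime_idealMl // (fP _ qs).2 // rp.
  by rewrite prime_idealMr // (fP _ ps).2.
exists s, e; split => //.
- exact: undup_uniq.
- move=> p ps; split; first by apply: s0P; rewrite -sE.
  have [h eh] := eE p; have [k ek] := subr1_exp (f p) n.
  have -> : e p * e p - e p = - (h * k ^+ n) * (f p * (1 - f p)) ^+ n.
    have -> : e p * e p - e p = - (e p * (1 - e p)) by ring.
    by rewrite {1}eh /e subKr ek !exprMn; ring.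
  apply: ideal_closedM => //; apply: nil => q qs.
  have [->|qp] := pselect (q = p); first by rewrite prime_idealMl // (fP _ ps).1.
  by rewrite prime_idealMr // (fP _ ps).2.
(* By orthogonality the product of the 1 - e p is congruent to 1 minus their sum; over all of [s]
   this product is the n-th power of an element of every prime. *)
- have cong (t : seq (prime_ideal o)) : uniq t -> {subset t <= s} ->
     \prod_(p <- t) (1 - e p) - (1 - \sum_(p <- t) e p) \in I.
    elim: t => [_ _|p t IH /= /andP[pt ut] ts].
      by rewrite !big_nil subr0 subrr ideal_closed0.
    have ps : p \in s := ts _ (mem_head _ _).
    have {}ts : {subset t <= s} by move=> q qt; apply: ts; rewrite inE qt orbT.
    have {}IH := IH ut ts; rewrite !big_cons.
    move: IH; set P := \prod_(_ <- _) _; set S := \sum_(_ <- _) _ => IH.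
    have -> : (1 - e p) * P - (1 - (e p + S)) =
              (1 - e p) * (P - (1 - S)) + e p * S by ring.
    apply: ideal_closedD => //; first exact: ideal_closedM.
    rewrite mulr_sumr; apply: ideal_closed_sum => // q qt _.
    by apply: ortho => //; [exact: ts|move=> pq; rewrite pq qt in pt].
  have := cong s (undup_uniq _) (fun _ h => h).
  set S := 1 - _; set P := \prod_(_ <- _) _ => PS.
  rewrite -[S](subKr P); apply: ideal_closedB => //.
  have -> : P = (\prod_(p <- s) (1 - f p ^+ n)) ^+ n.
    by rewrite -prodrXl; apply: eq_bigr => p _; rewrite /e subKr.
  apply: nil => p ps; rewrite (big_rem _ ps) /= prime_idealMr //.
  by have [h ->] := subr1_exp (f p) n; rewrite prime_idealMr // (fP _ ps).1.
- move=> p x ps xp.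
  have [y xy] : exists y, 1 - x * y \in p.
    by apply: prime_ideal_invertible => //; apply: s0P; rewrite -sE.
  (* Truncated geometric series: an inverse y of x modulo p is improved to one with error (1 - x *
     y)^n, which e p kills modulo [I]. *)
  have [h eh] := subr1_expl (x * y) n; exists (y * h).
  have -> : 1 - x * (y * h) = (1 - x * y) ^+ n by rewrite mulrA -eh subKr.
  have [k ->] := eE p; rewrite mulrAC -exprMn mulrC; apply: ideal_closedM => //.
  apply: nil => q qs.
  have [->|qp] := pselect (q = p); first by rewrite prime_idealMl.
  by rewrite prime_idealMr // (fP _ ps).2.
Qed.

End Dedekind.

(** * Uniformizers and the square of a prime *)

Section Uniformizer.
Variables (o : idomainType) (ho : dedekind_domain o).
Implicit Types (p q : prime_ideal o) (x y : o).

(** Multiplication by b/a preserves the finitely generated ideal p. The row of generators is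
    therefore a nonzero eigenvector of a matrix over o with eigenvalue b/a, so b/a is a root of a
    monic characteristic polynomial and lies in o. *)
Lemma stable_ideal_integral p (b a : o) : nonzero_ideal p -> a != 0 ->
  (forall x, x \in p -> exists2 s, s \in p & b * x = a * s) ->
  exists k, b = a * k.
Proof.
move=> [x0 x0n x0p] a0 stab.
have [v vP] := dedekind_noetherian ho (prime_closed p).
set m := size v in vP *.
have exr (i : 'I_m) : exists c : o ^ m, b * v`_i = a * \sum_(j < m) c j * v`_j.
  have /stab[s /vP[c ->] e] : v`_i \in p.
    apply/vP; exists [ffun j : 'I_m => (j == i)%:R].
    rewrite (bigD1 i) //= ffunE eqxx mul1r big1 ?addr0 // => j ne.
    by rewrite ffunE (negbTE ne) mul0r.
  by exists c.
have [c cP] := choice exr.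
pose M : 'M[o]_m := \matrix_(j, i) c i j.
pose K := {fraction o}; pose z : K := tofrac b / tofrac a.
have ta : tofrac a != 0 :> K by rewrite tofrac_eq0.
have [k ek] : exists x : o, z = tofrac x.
  apply: (dedekind_integrally_closed ho); exists (char_poly M).
    exact: char_poly_monic.
  rewrite map_char_poly -eigenvalue_root_char; apply/eigenvalueP.
  exists (\row_j tofrac v`_j).
    apply/rowP => i; rewrite !mxE.
    transitivity (tofrac (\sum_(j < m) c i j * v`_j)).
      rewrite rmorph_sum; apply: eq_bigr => j _.
      by rewrite !mxE rmorphM mulrC.
    apply: (mulfI ta); rewrite -rmorphM -cP mulrA [tofrac a * z]mulrC divfK //.
    by rewrite -rmorphM.
  apply/eqP => /rowP v0; move/eqP: x0n; apply.
  have /vP[d ->] := x0p; rewrite big1 // => j _.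
  by have := v0 j; rewrite !mxE => /eqP; rewrite tofrac_eq0 => /eqP->; rewrite mulr0.
have {ek} : tofrac b = tofrac k * tofrac a :> K by rewrite -ek divfK.
rewrite -tofracM => /eqP; rewrite tofrac_eq => /eqP ->.
by exists k; rewrite mulrC.
Qed.

(** Locally at p a product of primes is a power of p: each prime of [s] other than p contributes an
    element outside p, all collected in [f], and [n] is the multiplicity of p in [s]. *)
Lemma prime_product_at p (s : seq (prime_ideal o)) : nonzero_ideal p ->
  (forall q, q \in s -> nonzero_ideal q) ->
  exists2 f, f \notin p & exists n, forall xs : seq o, size xs = n ->
    (forall x, x \in xs -> x \in p) ->
    exists2 ys, all2 (fun q y => y \in (q : prime_ideal o)) s ys
      & \prod_(y <- ys) y = f * \prod_(x <- xs) x.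
Proof.
move=> p0; elim: s => [|q s IH] s0.
  exists 1; first by rewrite prime_ideal1.
  by exists 0%N => xs /size0nil -> _; exists [::] => //; rewrite mul1r.
have [|f fp [n nP]] := IH; first by move=> r rs; apply: s0; rewrite inE rs orbT.
have [->|qp] := pselect (q = p).
  exists f => //; exists n.+1 => -[//|x xs] /= [sz] xsp.
  have [|ys h e] := nP xs sz; first by move=> y yx; apply: xsp; rewrite inE yx orbT.
  exists (x :: ys); first by rewrite /= h xsp ?mem_head.
  by rewrite !big_cons e mulrCA.
have [g gq gp] : exists2 g : o, g \in q & g \notin p.
  by apply: prime_ideal_separated => //; [exact: s0 (mem_head _ _)|exact: nesym].
exists (f * g); first by rewrite prime_idealM negb_or fp gp.
exists n => xs sz xsp; have [ys h e] := nP xs sz xsp.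
exists (g :: ys); first by rewrite /= h andbT.
by rewrite big_cons e; ring.
Qed.

(* [o] localised at [p] is a discrete valuation ring with uniformizer [pi]. *)
Lemma local_uniformizer p : nonzero_ideal p ->
  exists pi s, [/\ pi \in p, s \notin p &
    forall x, x \in p -> exists k, s * x = pi * k].
Proof.
move=> p0; have [a a0 ap] := p0.
pose aI := ideal_adjoin (pred1 (0 : o)) a.
have aIP x : x \in aI <-> exists k, x = a * k.
  split=> [/ideal_adjoinP[u [k [/eqP-> ->]]]|[k ->]].
    by exists k; ring.
  by apply/ideal_adjoinP; exists 0, k; split; [exact: eqxx|ring].
have haI : ideal_closed aI by apply: ideal_adjoin_closed; apply: zero_ideal_closed.
have aI0 : nonzero_ideal aI.
  by exists a => //; apply: mem_ideal_adjoin; apply: zero_ideal_closed.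
have [s [s0 sP]] := prime_product ho haI aI0.
have [f fp [n nP]] := prime_product_at p0 s0.
(* Q n says that f times p^n lies in the principal ideal (a). For the least such n, a product of n -
   1 elements of p leads to an element b/a outside o that maps p into o. *)
pose Q n := forall xs : seq o, size xs = n ->
    (forall x, x \in xs -> x \in p) -> exists k, f * \prod_(x <- xs) x = a * k.
have exQ : exists n, `[< Q n >].
  exists n; apply/asboolP => xs sz xsp; have [ys h <-] := nP xs sz xsp.
  by apply/aIP; exact: sP.
have [m /asboolP mQ mmin] := ex_minnP exQ.
case: m => [|m] in mQ mmin.
  have [|k] := mQ [::] erefl; first by [].
  rewrite big_nil mulr1 => fak; move: fp; rewrite fak.
  by rewrite prime_idealMr.
have nQ : ~ Q m by move=> /asboolP /mmin; rewrite ltnn.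
have [b nb bp] : exists2 b, ~ (exists k, b = a * k) &
    forall x, x \in p -> exists k, b * x = a * k.
  apply: contrapT => no; apply: nQ => xs sz xsp; apply: contrapT => nk; apply: no.
  exists (f * \prod_(x <- xs) x) => // x xp.
  have [||k e] := mQ (x :: xs); first by rewrite /= sz.
    by move=> y; rewrite inE => /predU1P[->|/xsp].
  by exists k; rewrite -e big_cons; ring.
(* Otherwise b/a would map p into p and be integral over o. With b * pi = a * t, each x in p
   satisfies a * t * x = pi * (b * x), and b * x is again a multiple of a. *)
have [pi pip [t tp e]] : exists2 pi, pi \in p &
    exists2 t, t \notin p & b * pi = a * t.
  apply: contrapT => no; apply: nb; apply: (stable_ideal_integral p0 a0) => x xp.
  have [k e] := bp x xp; exists k => //; apply: contrapT => kp; apply: no.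
  by exists x => //; exists k => //; apply/negP.
exists pi, t; split=> // x xp; have [k ek] := bp x xp; exists k.
apply: (mulfI a0); rewrite mulrA -e.
have -> : b * pi * x = pi * (b * x) by ring.
by rewrite ek; ring.
Qed.

Lemma ideal_sqP p x : reflect (exists s : seq (o * o),
    {in s, forall uv, uv.1 \in p /\ uv.2 \in p} /\
    x = \sum_(uv <- s) uv.1 * uv.2) (x \in ideal_sq p).
Proof. exact: asboolP. Qed.

Lemma ideal_sq_closed p : ideal_closed (ideal_sq p : {pred o}).
Proof. exact: idealr_ideal_closed. Qed.

Lemma mem_ideal_sq p x y : x \in p -> y \in p -> x * y \in ideal_sq p.
Proof.
move=> xp yp; apply/ideal_sqP; exists [:: (x, y)]; split; last by rewrite big_seq1.
by move=> uv; rewrite inE => /eqP ->.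
Qed.

Lemma sub_ideal_sq p x : x \in ideal_sq p -> x \in p.
Proof.
move=> /ideal_sqP[s [sp ->]]; apply: ideal_closed_sum; first exact: prime_closed.
by move=> uv /sp[u v] _; rewrite prime_idealMl.
Qed.

Lemma ideal_sq_ind p (P : o -> Prop) :
  P 0 -> (forall x y, P x -> P y -> P (x + y)) ->
  (forall u v, u \in p -> v \in p -> P (u * v)) ->
  forall x, x \in ideal_sq p -> P x.
Proof.
move=> P0 PD PM x /ideal_sqP[s [sp ->]]; rewrite big_seq.
by elim/big_ind: _ => // uv /sp[]; exact: PM.
Qed.

(** Any element of p outside p^2 is a uniformizer: it differs locally from a given one, [pi0], by a
    factor [c], and [c] in p would force [pi] into p^2. *)
Lemma local_uniformizer_sq p pi : nonzero_ideal p -> pi \in p ->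
  pi \notin ideal_sq p ->
  exists2 s, s \notin p & forall x, x \in p -> exists k, s * x = pi * k.
Proof.
move=> p0 pip pi2; have [pi0 [s [pi0p sp sP]]] := local_uniformizer p0.
have [c ec] := sP pi pip.
have cp : c \notin p.
  apply/negP => cp; have [t st] := prime_ideal_invertible ho p0 sp.
  move/negP: pi2; apply.
  have -> : pi = pi * (1 - s * t) + t * (s * pi) by ring.
  apply: ideal_closedD; [exact: ideal_sq_closed|exact: mem_ideal_sq|].
  apply: ideal_closedM; first exact: ideal_sq_closed.
  by rewrite ec; apply: mem_ideal_sq.
exists (c * s); first by rewrite prime_idealM negb_or cp sp.
move=> x /sP[k ek]; exists (s * k).
by rewrite -mulrA ek mulrCA mulrA -ec; ring.
Qed.

(** Every element of p^2, multiplied by s^2, becomes a multiple of pi^2. If [pi] were in p^2,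
    cancelling [pi] would put s^2 into p. *)
Lemma uniformizer_notin_sq p pi s : nonzero_ideal p -> s \notin p -> pi \in p ->
  (forall x, x \in p -> exists k, s * x = pi * k) -> pi != 0 ->
  pi \notin ideal_sq p.
Proof.
move=> p0 sp pip sP pi0; apply/negP => pi2.
have /(_ _ pi2)[k ek] : forall x, x \in ideal_sq p -> exists k, s * s * x = pi * pi * k.
  apply: ideal_sq_ind.
  - by exists 0; ring.
  - by move=> x y [k ek] [l el]; exists (k + l); rewrite mulrDr ek el; ring.
  - move=> u v /sP[k ek] /sP[l el]; exists (k * l).
    have -> : s * s * (u * v) = (s * u) * (s * v) by ring.
    by rewrite ek el; ring.
move: sp; suff : s * s \in p by rewrite prime_idealM orbb => ->.
have -> : s * s = pi * k by apply: (mulfI pi0); rewrite mulrC ek; ring.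
by rewrite prime_idealMr.
Qed.

Lemma local_uniformizer_exists p : nonzero_ideal p ->
  exists2 pi, pi \in p /\ pi \notin ideal_sq p &
  exists2 s, s \notin p & forall x, x \in p -> exists k, s * x = pi * k.
Proof.
move=> p0; have [pi [s [pip sp sP]]] := local_uniformizer p0.
exists pi; last by exists s.
split=> //; apply: (uniformizer_notin_sq p0 sp pip sP).
apply/eqP => pi0; have [x x0 xp] := p0; have [k /eqP] := sP x xp.
rewrite pi0 mul0r mulf_eq0 (negbTE x0) orbF => /eqP s0.
by move: sp; rewrite s0 prime_ideal0.
Qed.

End Uniformizer.

(** * Residue rings *)

Lemma ring_isomorphic_inv (A B : nzRingType) (g : {rmorphism B -> A}) :
  bijective g -> ring_isomorphic A B.
Proof.
case=> f gf fg.
pose F := HB.pack_for {rmorphism A -> B} f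
  (GRing.isZmodMorphism.Build A B f (can2_zmod_morphism gf fg))
  (GRing.isMonoidMorphism.Build A B f (can2_monoid_morphism gf fg)).
by exists F; exists g.
Qed.

Lemma inj_surj_bijective (A B : choiceType) (g : B -> A) :
  injective g -> (forall x, exists y, g y = x) -> bijective g.
Proof.
move=> gi gs; have [f fP] := choice gs.
by exists f => // y; apply: gi; rewrite fP.
Qed.

Lemma natr_modn (A : pzRingType) n k : n%:R = 0 :> A -> (k %% n)%:R = k%:R :> A.
Proof. by move=> h; rewrite {2}(divn_eq k n) natrD natrM h mulr0 add0r. Qed.

Section RingOfIntegersMod.
Variables (A : comNzRingType) (m : nat).
Hypothesis A0 : m.+2%:R = 0 :> A.

Definition natr_ord (i : 'I_m.+2) : A := (i : nat)%:R.

Fact natr_ord_zmod_morphism : zmod_morphism natr_ord.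
Proof.
have D i j : natr_ord (i + j) = natr_ord i + natr_ord j.
  by rewrite /natr_ord -natrD -(natr_modn (i + j) A0).
move=> i j; have := D (i - j) j; rewrite subrK => ->; ring.
Qed.

Fact natr_ord_monoid_morphism : GRing.monoid_morphism natr_ord.
Proof.
split=> [|i j]; first exact: (natr_modn 1 A0).
by rewrite /natr_ord -natrM -(natr_modn (i * j) A0).
Qed.

Definition natr_ord_rmorphism : {rmorphism 'I_m.+2 -> A} :=
  HB.pack_for {rmorphism 'I_m.+2 -> A} natr_ord
  (GRing.isZmodMorphism.Build 'I_m.+2 A natr_ord natr_ord_zmod_morphism)
  (GRing.isMonoidMorphism.Build 'I_m.+2 A natr_ord natr_ord_monoid_morphism).

End RingOfIntegersMod.

Section QuotientIso.
Variables (A : comNzRingType) (I : idealr A).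

Lemma quot_map_surj (y : {ideal_quot I}) : exists x, quot_map I x = y.
Proof. by exists (repr y); rewrite /= reprK. Qed.

Lemma quot_map_eq0 x : quot_map I x = 0 <-> x \in I.
Proof.
rewrite -(rmorph0 (quot_map I)) /=.
rewrite -[x \in I]/(x \in (I : {pred A})) -{2}[x]subr0 Quotient.idealrBE.
by split=> [->|/eqP].
Qed.

Lemma quot_isomorphic_Zp m : m.+2%:R \in I ->
  (forall k, (0 < k < m.+2)%N -> k%:R \notin I) ->
  (forall x, exists k, x - k%:R \in I) ->
  ring_isomorphic {ideal_quot I} 'I_m.+2.
Proof.
move=> mI nI gI.
have A0 : m.+2%:R = 0 :> {ideal_quot I}.
  by rewrite -(rmorph_nat (quot_map I)); apply/quot_map_eq0.
apply: (@ring_isomorphic_inv _ _ (natr_ord_rmorphism A0)).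
apply: inj_surj_bijective.
  apply: raddf_inj => i /=; rewrite /natr_ord => i0.
  apply: val_inj => /=; apply/eqP; rewrite -leqn0 leqNgt; apply/negP => ip.
  have := nI i; rewrite ip ltn_ord => /(_ isT) /negP; apply.
  by apply/quot_map_eq0; rewrite rmorph_nat.
move=> y; have [x <-] := quot_map_surj y; have [k kI] := gI x.
exists (inZp k) => /=; rewrite /natr_ord /= natr_modn //.
rewrite -(rmorph_nat (quot_map I)); apply/eqP; rewrite eq_sym -subr_eq0.
by rewrite -rmorphB; apply/eqP/quot_map_eq0.
Qed.

End QuotientIso.

(** The isomorphism inside [pullback] is an arbitrary choice. All later arguments see it only
    through the composite [f], known by its surjectivity and its kernel. *)
Lemma pullbackE (R : realType) (o : idomainType) (B : comNzRingType)
    (eps : SL2 B -> R[i]) (I : idealr o) : ring_isomorphic {ideal_quot I} B ->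
  exists f : {rmorphism o -> B}, [/\ forall y, exists x, f x = y,
    forall x, f x = 0 <-> x \in I &
    pullback eps I = fun M => eps (SL2_map f M)].
Proof.
move=> iso; rewrite /pullback; case: pselect => // {}iso.
case: (cid iso) => g /= gb; exists (g \o quot_map I); split.
- move=> y; case: gb => h gh hg; have [x xy] := quot_map_surj (h y).
  by exists x; rewrite /= -[X in g X]/(quot_map I x) xy.
- move=> x /=; rewrite -quot_map_eq0; split=> [|/= ->]; last by rewrite rmorph0.
  by rewrite -(rmorph0 g) => /(bij_inj gb).
- apply/funext => M; congr eps; apply: val_inj; apply/matrixP => i j.
  by rewrite !mxE.
Qed.

(** * Coordinates on F_2[t]/(t^2) *)

Section F2t2.
Implicit Types x y : F2t2.
Let h : {poly 'F_2} := 'X^2.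

Definition dig0 x : 'F_2 := (x : {poly 'F_2})`_0.
Definition dig1 x : 'F_2 := (x : {poly 'F_2})`_1.

Lemma F2t2_eq x y : dig0 x = dig0 y -> dig1 x = dig1 y -> x = y.
Proof.
move=> e0 e1; apply/npolyP => -[|[|i]] //.
have sz (z : F2t2) : (size (z : {poly 'F_2}) <= 2)%N.
  rewrite -ltnS; apply: leq_trans (size_mk_monic (h := h) z) _.
  by rewrite mk_monic_Xn size_polyXn.
by rewrite !nth_default // (leq_trans (sz _)).
Qed.

Lemma dig0D x y : dig0 (x + y) = dig0 x + dig0 y.
Proof. by rewrite /dig0 poly_of_qpolyD coefD. Qed.
Lemma dig1D x y : dig1 (x + y) = dig1 x + dig1 y.
Proof. by rewrite /dig1 poly_of_qpolyD coefD. Qed.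

Lemma coef_modX2 (p : {poly 'F_2}) i : (i < 2)%N -> (Pdiv.CommonRing.rmodp p (mk_monic h))`_i = p`_i.
Proof.
rewrite mk_monic_Xn => i2; have := Pdiv.RingMonic.rdivp_eq (monicXn 'F_2 2) p => {2}->.
by rewrite coefD coefMXn i2 add0r.
Qed.

Lemma dig0M x y : dig0 (x * y) = dig0 x * dig0 y.
Proof.
rewrite /dig0 poly_of_qpolyM.
by rewrite coef_modX2 // coefM big_ord_recl big_ord0 addr0 /= subnn.
Qed.
Lemma dig1M x y : dig1 (x * y) = dig0 x * dig1 y + dig1 x * dig0 y.
Proof.
rewrite /dig0 /dig1 poly_of_qpolyM.
by rewrite coef_modX2 // coefM 2!big_ord_recl big_ord0 addr0.
Qed.

Lemma dig0C a : dig0 (qpolyC h a) = a.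
Proof. by rewrite /dig0 qpolyCE coefC. Qed.
Lemma dig1C a : dig1 (qpolyC h a) = 0.
Proof. by rewrite /dig1 qpolyCE coefC. Qed.

Lemma dig0_1 : dig0 1 = 1. Proof. exact: dig0C. Qed.
Lemma dig1_1 : dig1 1 = 0. Proof. exact: dig1C. Qed.

Lemma dig0_alpha : dig0 alpha = 0.
Proof. by rewrite /dig0 /alpha qpolyXE ?size_polyXn ?monicXn // coefX. Qed.
Lemma dig1_alpha : dig1 alpha = 1.
Proof. by rewrite /dig1 /alpha qpolyXE ?size_polyXn ?monicXn // coefX. Qed.

End F2t2.

(** * Primes with residue field F_2 or F_3, and the ring o/p^2 *)

Section ResidueFields.
Variables (o : idomainType) (ho : dedekind_domain o).
Implicit Types (p q : prime_ideal o) (x y : o).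

(** If p were zero, o itself would be a field, which [dedekind_not_field] excludes. *)
Lemma residue_field_nonzero p (F : fieldType) :
  ring_isomorphic {ideal_quot p} F -> nonzero_ideal p.
Proof.
move=> [g gb]; apply: contrapT => p0; apply: (dedekind_not_field ho) => x x0.
have g0 y : g (quot_map p y) = 0 <-> y \in p.
  split=> [|yp]; last by rewrite ((quot_map_eq0 p y).2 yp) rmorph0.
  by rewrite -(rmorph0 g) => /(bij_inj gb)/quot_map_eq0.
have gx : g (quot_map p x) != 0.
  by apply/eqP => /g0 xp; apply: p0; exists x.
case: gb => h gh hg; have [y ey] := quot_map_surj (h (g (quot_map p x))^-1).
apply/unitrPr; exists y; apply/eqP; rewrite -subr_eq0; apply: contrapT => /negP n0.
apply: p0; exists (x * y - 1) => //; apply/g0.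
by rewrite rmorphB rmorph1 rmorphM ey rmorphB rmorphM hg rmorph1 divff // subrr.
Qed.

Lemma residue_F2 p : ring_isomorphic {ideal_quot p} 'F_2 ->
  (2 \in p) /\ forall x, x \in p \/ 1 - x \in p.
Proof.
move=> [g gb].
have g0 y : g (quot_map p y) = 0 -> y \in p.
  by rewrite -(rmorph0 g) => /(bij_inj gb)/quot_map_eq0.
split; first by apply: g0; rewrite !rmorph_nat; apply: val_inj.
move=> x; case E: (g (quot_map p x)) => [[|[|//]] lt2].
  by left; apply: g0; rewrite E; apply: val_inj.
by right; apply: g0; rewrite !rmorphB !rmorph1 E; apply: val_inj.
Qed.

(** In a field where every nonzero u satisfies u^2 = 1, the only nonzero elements are 1 and -1. They
    coincide exactly when 2 is in p. *)
Lemma residue_classification p : nonzero_ideal p ->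
  (forall u, u \notin p -> u * u - 1 \in p) ->
  ring_isomorphic {ideal_quot p} 'F_2 \/ ring_isomorphic {ideal_quot p} 'F_3.
Proof.
move=> p0 up.
have pm u : u \notin p -> u - 1 \in p \/ u + 1 \in p.
  move=> /up; have -> : u * u - 1 = (u - 1) * (u + 1) by ring.
  by rewrite prime_idealM => /orP.
have p1 : (1 : o) \notin p by rewrite prime_ideal1.
have [p2|p2] := boolP ((2 : o) \in p); [left|right].
  apply: (@quot_isomorphic_Zp _ p 0) => //.
    by case=> [|[|k]] //.
  move=> x; have [xp|xp] := boolP (x \in p); first by exists 0%N; rewrite subr0.
  exists 1%N; have [//|xp1] := pm _ xp.
  have -> : x - 1%:R = (x + 1) - 2 by ring.
  exact: prime_idealB.
have p3 : (3 : o) \in p by rewrite (_ : 3 = 2 * 2 - 1) ?up //; ring.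
apply: (@quot_isomorphic_Zp _ p 1) => //.
  by case=> [|[|[|k]]].
move=> x; have [xp|xp] := boolP (x \in p); first by exists 0%N; rewrite subr0.
have [xp1|xp1] := pm _ xp; first by exists 1%N.
exists 2; have -> : x - 2%:R = (x + 1) - 3 by ring.
exact: prime_idealB.
Qed.

Section TwoAdic.
Variables (p : prime_ideal o) (p0 : nonzero_ideal p).
Hypothesis pF2 : ring_isomorphic {ideal_quot p} 'F_2.

(** The multiplier [s] of the uniformizer is congruent to 1 modulo p, so multiplying x - a by it
    changes nothing modulo p^2; thus x - a is congruent to pi * k, and only k modulo p matters. *)
Lemma mod_sq_digits pi x : pi \in p -> pi \notin ideal_sq p ->
  exists a b : bool, x - (a%:R + b%:R * pi) \in ideal_sq p.
Proof.
move=> pip pi2; have [_ F2] := residue_F2 pF2.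
have sqD := ideal_closedD (ideal_sq_closed p).
have digit y : exists a : bool, y - a%:R \in p.
  have [yp|yp] := F2 y; first by exists false; rewrite subr0.
  exists true; rewrite -opprB; apply: ideal_closedN => //; exact: prime_closed.
have [s sp sP] := local_uniformizer_sq ho p0 pip pi2.
have s1 : 1 - s \in p by have [sp'|//] := F2 s; rewrite sp' in sp.
have [a xa] := digit x; have [k ek] := sP _ xa; have [b kb] := digit k.
exists a, b.
have -> : x - (a%:R + b%:R * pi) = (1 - s) * (x - a%:R) + pi * (k - b%:R).
  have -> : pi * (k - b%:R) = pi * k - b%:R * pi by ring.
  by rewrite -ek; ring.
by apply: sqD; apply: mem_ideal_sq.
Qed.

(** Here 2 is a uniformizer, so the digits a + 2 b are binary expansions of 0, 1, 2, 3. *)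
Lemma quot_sq_Z4 : 2 \notin ideal_sq p ->
  ring_isomorphic {ideal_quot (ideal_sq p)} 'Z_4.
Proof.
move=> n2; have [p2 _] := residue_F2 pF2.
have sq k : k%:R \in ideal_sq p -> (k%:R : o) \in p by exact: sub_ideal_sq.
apply: (@quot_isomorphic_Zp _ (ideal_sq p) 2).
- have -> : 4 = 2 * 2 :> o by ring.
  exact: mem_ideal_sq.
- case=> [|[|[|[|k]]]] // _; apply/negP => /sq; first by rewrite prime_ideal1.
  move=> p3; have := prime_idealB p3 p2.
  have -> : 3%:R - 2 = 1 :> o by ring.
  by rewrite prime_ideal1.
- move=> x; have [a [b ab]] := mod_sq_digits x p2 n2.
  by exists (a + b * 2)%N; rewrite natrD natrM.
Qed.

Lemma quot_sq_F2t2 : 2 \in ideal_sq p ->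
  ring_isomorphic {ideal_quot (ideal_sq p)} F2t2.
Proof.
move=> sq2; have [p2 _] := residue_F2 pF2.
have [pi [pip pi2] _] := local_uniformizer_exists ho p0.
pose Q := {ideal_quot (ideal_sq p)}; pose t : Q := quot_map _ pi.
have q0 x : quot_map (ideal_sq p) x = 0 <-> x \in ideal_sq p by exact: quot_map_eq0.
have tt0 : t * t = 0 by rewrite -rmorphM; apply/q0; apply: mem_ideal_sq.
have Q2 : 2%:R = 0 :> Q by rewrite -(rmorph_nat (quot_map _)); apply/q0.
pose c := natr_ord_rmorphism Q2 : {rmorphism 'F_2 -> Q}.
(* This sends [alpha] to the class of the uniformizer; it is a ring map because 2 and pi^2 vanish in
   o/p^2. *)
pose g (x : F2t2) : Q := c (dig0 x) + c (dig1 x) * t.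
have gD (x y : F2t2) : g (x + y) = g x + g y by rewrite /g dig0D dig1D !rmorphD /=; ring.
have gB : zmod_morphism g by move=> x y; have := gD (x - y) y; rewrite subrK => ->; ring.
have gM : GRing.monoid_morphism g.
  split=> [|x y]; first by rewrite /g dig0_1 dig1_1 rmorph1 rmorph0; ring.
  have expand a b d e : (a + e * t) * (b + d * t) = a * b + (a * d + e * b) * t.
    transitivity (a * b + (a * d + e * b) * t + e * d * (t * t)); first by ring.
    by rewrite tt0; ring.
  by rewrite /g dig0M dig1M rmorphD !rmorphM expand.
pose G := HB.pack_for {rmorphism F2t2 -> Q} g
  (GRing.isZmodMorphism.Build F2t2 Q g gB)
  (GRing.isMonoidMorphism.Build F2t2 Q g gM).
apply: (@ring_isomorphic_inv _ _ G); apply: inj_surj_bijective.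
  apply: raddf_inj => x /=; rewrite /g /= /natr_ord.
  rewrite -!(rmorph_nat (quot_map (ideal_sq p))) /t -rmorphM -rmorphD.
  move=> /q0 h.
  have x0 : dig0 x = 0.
    move/sub_ideal_sq: h; case: (dig0 x) => [[|[|//]] ?] h; apply: val_inj => //=.
    move: h => /= h; have := prime_idealB h (prime_idealMl (dig1 x)%:R pip).
    by rewrite addrK prime_ideal1.
  apply: F2t2_eq; rewrite ?[dig0 0]dig0C ?[dig1 0]dig1C //.
  move: h; rewrite x0 /= add0r.
  case: (dig1 x) => [[|[|//]] ?] /= h; apply: val_inj => //=.
  by move: h; rewrite mul1r (negbTE pi2).
move=> y; have [x <-] := quot_map_surj y.
have [a [b ab]] := mod_sq_digits x pip pi2.
have small (u : bool) : c u%:R = u%:R by rewrite rmorph_nat.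
exists (qpolyC _ a%:R + alpha * qpolyC _ b%:R) => /=; rewrite /g.
rewrite dig0D dig1D dig0M dig1M !dig0C !dig1C dig0_alpha dig1_alpha.
rewrite mul0r addr0 add0r mul0r add0r mul1r !small; apply/eqP.
rewrite eq_sym -subr_eq0 -!(rmorph_nat (quot_map (ideal_sq p))) /t -rmorphM -rmorphD -rmorphB.
by apply/eqP/q0.
Qed.

End TwoAdic.

End ResidueFields.

(** * The finite characters as roots of unity *)

Section TwoByTwo.
Variable A : comNzRingType.
Implicit Types (a b c d x y : A) (M N : SL2 A).

Definition mx2 a b c d : 'M[A]_2 :=
  \matrix_(i < 2, j < 2)
    if i == 0 then (if j == 0 then a else b) else (if j == 0 then c else d).

Lemma ord2P (i : 'I_2) : i = 0 \/ i = 1.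
Proof. by case: i => [[|[|//]] ?]; [left|right]; apply: val_inj. Qed.

Lemma matrix2P (P Q : 'M[A]_2) :
  P 0 0 = Q 0 0 -> P 0 1 = Q 0 1 -> P 1 0 = Q 1 0 -> P 1 1 = Q 1 1 -> P = Q.
Proof. by move=> *; apply/matrixP => i j; case: (ord2P i) (ord2P j) => -> [] ->. Qed.

Lemma mulmx2E (P Q : 'M[A]_2) i j : (P *m Q) i j = P i 0 * Q 0 j + P i 1 * Q 1 j.
Proof.
by rewrite mxE big_ord_recl big_ord1; congr (_ + P _ _ * Q _ _); apply: val_inj.
Qed.

Lemma det2E (P : 'M[A]_2) : \det P = P 0 0 * P 1 1 - P 0 1 * P 1 0.
Proof.
rewrite (expand_det_row _ 0) big_ord_recl big_ord1 /cofactor !det_mx11 !mxE /=.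
rewrite expr0 expr1 mul1r mulN1r mulrN.
by congr (_ * P _ _ - P _ _ * P _ _); apply: val_inj.
Qed.

Lemma trace2E (P : 'M[A]_2) : \tr P = P 0 0 + P 1 1.
Proof.
by rewrite /mxtrace big_ord_recl big_ord1; congr (_ + P _ _); apply: val_inj.
Qed.

Lemma SL2_detE M : M 0 0 * M 1 1 - M 0 1 * M 1 0 = 1.
Proof. by rewrite -det2E det_SL2. Qed.

Lemma SL2_eq M N : M 0 0 = N 0 0 -> M 0 1 = N 0 1 -> M 1 0 = N 1 0 ->
  M 1 1 = N 1 1 -> M = N.
Proof. by move=> *; apply: val_inj; apply: matrix2P. Qed.

Lemma SL2_mulE M N i j : (M * N)%g i j = M i 0 * N 0 j + M i 1 * N 1 j.
Proof. exact: mulmx2E. Qed.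

Fact mx2_det_subproof a b c d : a * d - b * c = 1 -> \det (mx2 a b c d) == 1.
Proof. by move=> h; rewrite det2E !mxE /= h. Qed.

Definition SL2_of a b c d (h : a * d - b * c = 1) : SL2 A :=
  MkSL2 (mx2_det_subproof h).

Fact upper_subproof x : 1 * 1 - x * 0 = 1 :> A. Proof. ring. Qed.
Fact lower_subproof x : 1 * 1 - 0 * x = 1 :> A. Proof. ring. Qed.
Definition upper x : SL2 A := SL2_of (upper_subproof x).
Definition lower x : SL2 A := SL2_of (lower_subproof x).

End TwoByTwo.

Lemma SL2_map_upper (A B : comNzRingType) (f : {rmorphism A -> B}) x :
  SL2_map f (upper x) = upper (f x).
Proof. by apply: SL2_eq; rewrite !mxE /= ?rmorph0 ?rmorph1. Qed.

Lemma SL2_mapM (A B : comNzRingType) (f : {rmorphism A -> B}) (M N : SL2 A) :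
  SL2_map f (M * N)%g = (SL2_map f M * SL2_map f N)%g.
Proof. by apply: val_inj; rewrite /= map_mxM. Qed.

(** * Additivity of the exponents by enumeration *)

Section FiniteCheck.
Variable m : nat.
Let Z := 'I_m.+2.
Let quad := (Z * Z * Z * Z)%type.
Implicit Types q : quad.

(** Matrices are recoded as quadruples of residues, which evaluate under [vm_compute]; the
    homomorphism property is then tested on all pairs of determinant 1. *)
Definition quad_mul q q' : quad :=
  let: (a, b, c, d) := q in let: (a', b', c', d') := q' in
  (a * a' + b * c', a * b' + b * d', c * a' + d * c', c * b' + d * d').

Definition quad_det q : Z := let: (a, b, c, d) := q in a * d - b * c.

Definition all_Z : seq Z := [seq inZp i | i <- iota 0 m.+2].

Definition quads : seq quad :=
  [seq (ab.1, ab.2, cd.1, cd.2) | ab <- [seq (a, b) | a <- all_Z, b <- all_Z],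
                                  cd <- [seq (c, d) | c <- all_Z, d <- all_Z]].

Lemma mem_all_Z (a : Z) : a \in all_Z.
Proof. by apply/mapP; exists (a : nat); rewrite ?mem_iota ?ltn_ord ?valZpK. Qed.

Lemma mem_quads q : q \in quads.
Proof.
case: q => [[[a b] c] d]; apply/allpairsP; exists ((a, b), (c, d)).
by split=> //; apply/allpairsP; [exists (a, b)|exists (c, d)]; split => //; exact: mem_all_Z.
Qed.

Definition quad_of (M : 'M[Z]_2) : quad := (M 0 0, M 0 1, M 1 0, M 1 1).

Definition quad_hom (k : quad -> Z) : bool :=
  let s := [seq q <- quads | quad_det q == 1] in
  all (fun q => all (fun q' => k (quad_mul q q') == k q + k q') s) s.

Lemma quad_homP (k : quad -> Z) : quad_hom k -> forall M N : SL2 Z,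
  k (quad_of (M * N)%g) = k (quad_of M) + k (quad_of N).
Proof.
move=> h M N; have inG (P : SL2 Z) : quad_of P \in [seq q <- quads | quad_det q == 1].
  by rewrite mem_filter mem_quads andbT; apply/eqP; exact: SL2_detE.
have /allP/(_ _ (inG N))/eqP <- := allP h _ (inG M).
by congr k; rewrite /quad_of !SL2_mulE.
Qed.

Definition quad_even q : bool :=
  let: (a, b, c, d) := q in [&& odd a, ~~ odd b, ~~ odd c & odd d].

(** A computable form of [brace]: [coprime] decides invertibility, and [quad_even], relevant for N =
    4 only, replaces the existential statement of congruence to 1 modulo 2. *)
Definition brace_quad q : Z :=
  let: (a, b, c, d) := q in
  if [|| q == (1, 0, 0, 1), q == (-1, 0, 0, -1) | (m == 2) && quad_even q] then 0
  else if (a + d) ^+ 2 != 4 then 1 else if coprime m.+2 c then c else - b.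

Lemma quad_of_eq (M P : 'M[Z]_2) : (M == P) = (quad_of M == quad_of P).
Proof. by apply/eqP/eqP => [->//|[]]; exact: matrix2P. Qed.

End FiniteCheck.

Lemma even_Z4 (x : 'Z_4) : ~~ odd x -> x = 2 * inZp x./2.
Proof. by case: x => [[|[|[|[|//]]]] ?] //= _; apply: val_inj. Qed.

Lemma odd_double_Z4 (x : 'Z_4) : ~~ odd (2 * x : 'Z_4)%R /\ odd (1 + 2 * x : 'Z_4)%R.
Proof. by case: x => [[|[|[|[|//]]]] ?]. Qed.

Lemma congr1_mod2 (M : 'M['Z_4]_2) :
  [exists B : 'M['Z_4]_2, M == 1 + 2 *: B] = quad_even (quad_of M).
Proof.
apply/existsP/and4P => [[B /eqP ->]|[a b c d]].
  have diag i : (1 + 2 *: B) i i = 1 + 2 * B i i by rewrite !mxE eqxx.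
  have off i j : i != j -> (1 + 2 *: B) i j = 2 * B i j.
    by move=> ij; rewrite !mxE (negbTE ij) add0r.
  by rewrite !diag !off //; split; apply odd_double_Z4.
have odd1 (x : 'Z_4) : odd x -> x = 1 + 2 * inZp (x - 1 : 'Z_4)%R./2.
  by case: x => [[|[|[|[|//]]]] ?] //= _; apply: val_inj.
exists (mx2 (inZp (M 0 0 - 1 : 'Z_4)%R./2) (inZp (M 0 1)./2)
            (inZp (M 1 0)./2) (inZp (M 1 1 - 1 : 'Z_4)%R./2)).
apply/eqP/matrix2P; rewrite !mxE /=.
- exact: odd1.
- by rewrite add0r; exact: even_Z4.
- by rewrite add0r; exact: even_Z4.
- exact: odd1.
Qed.

Lemma braceE m (M : 'M['Z_m.+2]_2) : brace m.+2 M = brace_quad (quad_of M).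
Proof.
rewrite /brace /brace_quad /= trace2E.
have -> : (M == 1) = (quad_of M == (1, 0, 0, 1)).
  by rewrite quad_of_eq /quad_of !mxE.
have -> : (M == -1) = (quad_of M == (-1, 0, 0, -1)).
  by rewrite quad_of_eq /quad_of !mxE /= oppr0.
have -> : (m.+2 == 4%N) && [exists B, M == 1 + 2 *: B] = (m == 2) && quad_even (quad_of M).
  by rewrite !eqSS; case: eqVneq M => [-> M|//]; exact: congr1_mod2.
by rewrite -[M 1 0 in LHS]natr_Zp unitZpE // natr_Zp.
Qed.

(** The maps kappa_N are logarithms: eps_N is exp(2 pi i kappa_N / N), so multiplicativity of eps_N
    becomes additivity in Z/N. *)
Definition kappa2 (M : 'M['Z_2]_2) : 'Z_2 :=
  (M 0 0 + M 1 1 + 1) * brace_quad (quad_of M).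
Definition kappa3 (M : 'M['Z_3]_2) : 'Z_3 :=
  (M 0 0 + M 1 1) * brace_quad (quad_of M).
(** The second summand is the logarithm of [s_sign]: for M = 1 + 2 B the tested sum of entries is
    twice the sum of the three entries of B, and equals 2 exactly when that sum is odd. *)
Definition kappa4 (M : 'M['Z_4]_2) : 'Z_4 :=
  (M 0 0 + M 1 1 + 1) * brace_quad (quad_of M) +
  (if quad_even (quad_of M) && (M 0 0 - 1 + M 0 1 + M 1 0 == 2) then 2 else 0).

Lemma kappa2M (M N : SL2 'Z_2) : kappa2 (M * N)%g = kappa2 M + kappa2 N.
Proof.
apply: (@quad_homP 0 (fun q => let: (a, b, c, d) := q in (a + d + 1) * brace_quad q)).
by vm_compute.
Qed.

Lemma kappa3M (M N : SL2 'Z_3) : kappa3 (M * N)%g = kappa3 M + kappa3 N.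
Proof.
apply: (@quad_homP 1 (fun q => let: (a, b, c, d) := q in (a + d) * brace_quad q)).
by vm_compute.
Qed.

Lemma kappa4M (M N : SL2 'Z_4) : kappa4 (M * N)%g = kappa4 M + kappa4 N.
Proof.
apply: (@quad_homP 2 (fun q => let: (a, b, c, d) := q in (a + d + 1) * brace_quad q +
  (if quad_even q && (a - 1 + b + c == 2) then 2 else 0))).
by vm_compute.
Qed.

(** With this normalisation the additive character of eps_N is x -> exp(2 pi i x / N), a generator
    of the dual of Z/N; likewise for N = 3 and N = 4. *)
Lemma kappa2_upper x : kappa2 (upper x) = x.
Proof.
rewrite /kappa2 /quad_of !mxE /=.
by case: x => [[|[|//]] ?]; apply: val_inj.
Qed.

Lemma kappa3_upper x : kappa3 (upper x) = x.
Proof.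
rewrite /kappa3 /quad_of !mxE /=.
by case: x => [[|[|[|//]]] ?]; apply: val_inj.
Qed.

Lemma kappa4_upper x : kappa4 (upper x) = x.
Proof.
rewrite /kappa4 /quad_of !mxE /=.
by case: x => [[|[|[|[|//]]]] ?]; apply: val_inj.
Qed.

(* An element of SL(2, F2t2) is encoded by its residue [q.1] modulo alpha and *)
(* its coefficient [q.2] of alpha.                                            *)
Section DualNumbers.
Let quad := ('F_2 * 'F_2 * 'F_2 * 'F_2)%type.

Definition dual_mul (p q : quad * quad) : quad * quad :=
  let: (a, b, c, d) := quad_mul (m := 0) p.1 q.2 in
  let: (a', b', c', d') := quad_mul (m := 0) p.2 q.1 in
  (quad_mul (m := 0) p.1 q.1, (a + a', b + b', c + c', d + d')).

(* For M = M0 (1 + alpha B) = M0 + alpha M1 this is the matrix B = adj(M0) M1. *)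
Definition dual_log (p : quad * quad) : quad :=
  let: (a, b, c, d) := p.1 in quad_mul (m := 0) (d, - b, - c, a) p.2.

(** The determinant of M0 (1 + alpha B) is det M0 (1 + alpha tr B), so it is 1 exactly when det M0 =
    1 and tr B = 0. *)
Definition dual_det (p : quad * quad) : bool :=
  (quad_det (m := 0) p.1 == 1) &&
  (let: (a, _, _, d) := dual_log p in a + d == 0).

Definition dual_kappa (p : quad * quad) : 'F_2 :=
  let: (a, b, c, _) := dual_log p in a + b + c.

Definition dual_of (M : 'M[F2t2]_2) : quad * quad :=
  (quad_of (m := 0) (map_mx dig0 M), quad_of (m := 0) (map_mx dig1 M)).

Lemma dual_of_det (M : SL2 F2t2) : dual_det (dual_of M).
Proof.
have detM := SL2_detE M.
have F2N (x : 'F_2) : - x = x by case: x => [[|[|//]] ?]; apply: val_inj.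
have digN0 x : dig0 (- x) = dig0 x.
  by rewrite -[RHS]F2N; apply: (addrI (dig0 x)); rewrite -dig0D !subrr; exact: dig0C.
have digN1 x : dig1 (- x) = dig1 x.
  by rewrite -[RHS]F2N; apply: (addrI (dig1 x)); rewrite -dig1D !subrr; exact: dig1C.
move: (congr1 dig0 detM) (congr1 dig1 detM).
rewrite dig0D dig1D digN0 digN1 !dig0M !dig1M dig0_1 dig1_1 => e0 e1.
rewrite /dual_det /dual_log /dual_of /quad_of /=; apply/andP.
rewrite !mxE !F2N; split; apply/eqP; first exact: e0.
by rewrite -[RHS]e1; ring.
Qed.

Lemma map_mx_coef (f : F2t2 -> 'F_2) (M : 'M[F2t2]_2) i j :
  map_mx f M i j = f (M i j).
Proof. by rewrite mxE. Qed.

Lemma dual_ofM (M N : 'M[F2t2]_2) : dual_of (M *m N) = dual_mul (dual_of M) (dual_of N).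
Proof.
rewrite /dual_of /dual_mul /quad_of /= !map_mx_coef !mulmx2E.
rewrite !dig0D !dig1D !dig0M !dig1M.
by congr (_, (_, _, _, _)); ring.
Qed.

Definition duals : seq (quad * quad) :=
  [seq p <- [seq (q, q') | q <- quads 0, q' <- quads 0] | dual_det p].

Lemma dual_kappaM (M N : SL2 F2t2) :
  dual_kappa (dual_of (M * N)%g) = dual_kappa (dual_of M) + dual_kappa (dual_of N).
Proof.
have inG (P : SL2 F2t2) : dual_of P \in duals.
  rewrite mem_filter dual_of_det; apply/allpairsP.
  by exists (dual_of P); split; rewrite ?mem_quads //; case: (dual_of P).
rewrite dual_ofM.
(* The group has 6 * 8 = 48 elements; all pairs are evaluated. *)
have : all (fun p => all (fun q => dual_kappa (dual_mul p q) ==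
   dual_kappa p + dual_kappa q) duals) duals by vm_compute.
by move/allP/(_ _ (inG M))/allP/(_ _ (inG N))/eqP.
Qed.

Lemma dual_kappa_upper x : dual_kappa (dual_of (upper x)) = dig1 x.
Proof.
have d0 : dig0 0 = 0 by exact: dig0C.
have d1 : dig1 0 = 0 by exact: dig1C.
rewrite /dual_kappa /dual_log /dual_of /quad_of /= !map_mx_coef !mxE /=.
by rewrite dig0_1 dig1_1 d0 d1; ring.
Qed.

End DualNumbers.

(** * Roots of unity *)

Section RootsOfUnity.
Variables (R : realType) (m : nat).
Local Notation n := m.+2.
Implicit Types k : 'Z_n.

Definition cis (x : R) : R[i] := (cos x +i* sin x)%C.

Lemma cisD x y : cis (x + y) = cis x * cis y.
Proof. by rewrite /cis cosD sinD; simpc; rewrite [sin x * _ + _]addrC. Qed.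

Lemma cis_2piM j : cis (2 * pi * j%:R) = 1.
Proof.
have := periodicn (@cosD2pi R) j 0; have := periodicn (@sinD2pi R) j 0.
rewrite !add0r cos0 sin0 -[_ *+ j]mulr_natr -[_ *+ 2]mulr_natl => s c.
by rewrite /cis s c.
Qed.

Lemma e_modE k : e_mod R n k = cis (2 * pi * (k : nat)%:R / n%:R).
Proof. by []. Qed.

Lemma cis_e_mod j : cis (2 * pi * j%:R / n%:R) = e_mod R n (j%:R : 'Z_n).
Proof.
rewrite e_modE val_Zp_nat // {1}(divn_eq j n) natrD natrM mulrDr mulrDl cisD.
by rewrite mulrA mulfK ?pnatr_eq0 // cis_2piM mul1r.
Qed.

Lemma e_mod0 : e_mod R n 0 = 1.
Proof. by rewrite e_modE mulr0 mul0r /cis cos0 sin0. Qed.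

Lemma e_modD k l : e_mod R n (k + l) = e_mod R n k * e_mod R n l.
Proof.
rewrite -[k in LHS]natr_Zp -[l in LHS]natr_Zp -natrD -cis_e_mod natrD.
by rewrite mulrDr mulrDl cisD.
Qed.

Lemma e_modMn k j : e_mod R n (k *+ j) = e_mod R n k ^+ j.
Proof. by elim: j => [|j IH]; rewrite ?mulr0n ?e_mod0 // mulrS e_modD IH exprS. Qed.

Lemma e_mod_norm k : `|e_mod R n k| = 1.
Proof. by rewrite normc_def /= cos2Dsin2 sqrtr1. Qed.

(** The real part suffices. For k nonzero, y = pi k / n lies strictly between 0 and pi, where sin y
    > 0, while cos 2y = 1 would give sin y = 0. *)
Lemma e_mod_eq1 k : e_mod R n k = 1 -> k = 0.
Proof.
move=> [ck _]; apply: contrapT => /eqP k0.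
pose y : R := pi * (k : nat)%:R / n%:R.
have n0 : 0 < n%:R :> R by rewrite ltr0n.
have y0 : 0 < y.
  by rewrite divr_gt0 // mulr_gt0 ?pi_gt0 // ltr0n lt0n -[0%N]/(val (0 : 'Z_n)) val_eqE.
have ypi : y < pi.
  rewrite ltr_pdivrMr // ltr_pM2l ?pi_gt0 // ltr_nat; exact: ltn_ord k.
have sy : 0 < sin y by rewrite sin_gt0_pi ?y0.
have e : 2 * pi * (k : nat)%:R / n%:R = y *+ 2 by rewrite -[RHS]mulr_natl /y !mulrA.
move: ck (cos2Dsin2 y); rewrite e cos_mulr2n => /eqP.
rewrite subr_eq -[1 + 1]/(1 *+ 2) eqr_pMn2r // => /eqP ->.
rewrite -[RHS]addr0 => /addrI /eqP; rewrite sqrf_eq0 => /eqP s0.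
by rewrite s0 ltxx in sy.
Qed.

Lemma e_mod_primitive : n.-primitive_root (e_mod R n 1).
Proof.
apply/andP; split=> //; apply/forallP => i; apply/eqP.
rewrite unity_rootE -e_modMn; apply/eqP/eqP => [/e_mod_eq1/(congr1 (@nat_of_ord _))|->].
  rewrite val_Zp_nat //= => /eqP /dvdn_leq h.
  by apply/eqP; rewrite eqn_leq ltn_ord h.
by rewrite pchar_Zp // e_mod0.
Qed.

Lemma unity_e_mod (z : R[i]) : z ^+ n = 1 -> exists j : nat, z = e_mod R n 1 ^+ j.
Proof. by move/(prim_rootP e_mod_primitive) => [j ->]; exists j. Qed.

Lemma e_mod_exp k : e_mod R n k = e_mod R n 1 ^+ (k : nat).
Proof. by rewrite -e_modMn natr_Zp. Qed.

End RootsOfUnity.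

Section FiniteCharacters.
Variable R : realType.

Lemma eps2E (M : SL2 'Z_2) : eps2 R M = e_mod R 2 (kappa2 M).
Proof. by rewrite /eps2 trace2E braceE. Qed.

Lemma eps3E (M : SL2 'Z_3) : eps3 R M = e_mod R 3 (kappa3 M).
Proof. by rewrite /eps3 trace2E braceE. Qed.

Lemma e_mod_half : e_mod R 4 2 = -1.
Proof.
rewrite (e_modE R (m := 2)) /cis.
have -> : 2 * pi * ((2 : 'Z_4)%R : nat)%:R / 4%:R = pi :> R.
  by rewrite -[nat_of_ord _]/2%N; field.
by rewrite cospi sinpi; apply/eqP; rewrite eq_complex /= oppr0 !eqxx.
Qed.

Lemma s_signE (M : 'M['Z_4]_2) : s_sign R M =
  e_mod R 4 (if quad_even (quad_of M) && (M 0 0 - 1 + M 0 1 + M 1 0 == 2) then 2 else 0).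
Proof.
rewrite /s_sign; set b := [exists _, _]; set c := _ && _.
suff -> : b = c by case: ifP => _; rewrite ?e_mod_half // (e_mod0 R 2).
have entries (B : 'M['Z_4]_2) : M = 1 + 2 *: B ->
    M 0 0 - 1 + M 0 1 + M 1 0 = 2 * (B 0 0 + B 0 1 + B 1 0).
  by move=> ->; rewrite !mxE /=; ring.
have odd_double (x : 'Z_4) : (2 * x == 2) = odd x.
  by case: x => [[|[|[|[|//]]]] ?].
apply/existsP/andP => [[B /andP[/eqP MB oB]]|[]].
  rewrite -congr1_mod2; split; first by apply/existsP; exists B; apply/eqP.
  by rewrite (entries B) // odd_double.
rewrite -congr1_mod2 => /existsP[B /eqP MB]; rewrite (entries B) // odd_double.
by move=> oB; exists B; rewrite -MB eqxx.
Qed.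

Lemma eps4E (M : SL2 'Z_4) : eps4 R M = e_mod R 4 (kappa4 M).
Proof.
by rewrite /eps4 s_signE /kappa4 (e_modD R (m := 2)) mulrC trace2E braceE.
Qed.

Lemma sign_e_mod (x : 'F_2) : (-1) ^+ x = e_mod R 2 x :> R[i].
Proof.
case: x => [[|[|//]] lt2] /=.
  by rewrite expr0 -(e_mod0 R 0); congr e_mod; apply: val_inj.
rewrite expr1 (e_modE R (m := 0)) /cis /= mulr1 mulrAC divff ?mul1r ?pnatr_eq0 //.
by rewrite cospi sinpi; apply/eqP; rewrite eq_complex /= oppr0 !eqxx.
Qed.

Lemma eps4'E (M : SL2 F2t2) : eps4' R M = e_mod R 2 (dual_kappa (dual_of M)).
Proof.
have dig0nat (b : bool) : dig0 b%:R = b%:R by case: b; [exact: dig0_1|exact: dig0C].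
have dig1nat (b : bool) : dig1 b%:R = 0 by case: b; [exact: dig1_1|exact: dig1C].
have dig (M0 B : 'M['F_2]_2) i j :
    let P := lift_F2t2 M0 *m (1%:M + alpha *: lift_F2t2 B) in
    dig0 (P i j) = M0 i j /\ dig1 (P i j) = M0 i 0 * B 0 j + M0 i 1 * B 1 j.
  rewrite /= mulmx2E !mxE dig0D dig1D !dig0M !dig1M !dig0D !dig1D !dig0M !dig1M.
  rewrite dig0_alpha dig1_alpha !dig0C !dig1C !dig0nat !dig1nat.
  by split; [case: (ord2P j) => ->|]; rewrite /=; ring.
have detM := dual_of_det M.
have logE (M0 B : 'M['F_2]_2) : \det M0 = 1 ->
    (M : 'M[F2t2]_2) = lift_F2t2 M0 *m (1%:M + alpha *: lift_F2t2 B) ->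
    B 0 0 + B 0 1 + B 1 0 = dual_kappa (dual_of M).
  move=> det0 e; rewrite /dual_kappa /dual_log /dual_of /quad_of /= !map_mx_coef.
  rewrite !e !(dig _ _ _ _).1 !(dig _ _ _ _).2.
  by rewrite -[LHS]mul1r -{1}det0 det2E; ring.
rewrite /eps4'; case: pickP => [B /andP[_ /existsP[M0 /andP[/eqP det0 /eqP e]]]|no].
  by rewrite sign_e_mod (logE _ _ det0 e).
pose M0 := map_mx dig0 M : 'M['F_2]_2; pose M1 := map_mx dig1 M : 'M['F_2]_2.
(* This is B = adj(M0) M1; as det M0 = 1, M0 (1 + alpha B) = M0 + alpha M1, so [pick] cannot
   fail. *)
pose B := mx2 (M0 1 1 * M1 0 0 - M0 0 1 * M1 1 0) (M0 1 1 * M1 0 1 - M0 0 1 * M1 1 1)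
              (- M0 1 0 * M1 0 0 + M0 0 0 * M1 1 0) (- M0 1 0 * M1 0 1 + M0 0 0 * M1 1 1).
have det0 : M0 0 0 * M0 1 1 - M0 0 1 * M0 1 0 = 1.
  by have /andP[/eqP] := detM.
have /negP[] := no B; apply/andP; split.
  rewrite trace2E /B !mxE /=; have /andP[_] := detM.
  by rewrite /dual_of /quad_of /dual_log /= !map_mx_coef mulNr.
apply/existsP; exists M0; rewrite det2E det0 eqxx /=.
apply/eqP/matrix2P; apply: F2t2_eq;
  rewrite ?(dig _ _ _ _).1 ?(dig _ _ _ _).2 -?map_mx_coef // -/M0 -/M1;
  rewrite -[LHS]mul1r -{1}det0 ![B _ _]mxE /=; ring.
Qed.

End FiniteCharacters.

(** * Characters of SL(2,o) and additive characters of o *)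

Section CongruenceCharacters.
Variables (R : realType) (o : idomainType) (chi : SL2 o -> R[i]).
Hypothesis hchi : linear_character chi.
Variables (I : {pred o}) (hI : ideal_closed I).
Hypothesis chiI : (principal_congruence I `<=` [set M | chi M = 1])%classic.
Implicit Types (M N : SL2 o) (x y u v : o).

Let chiM M N : chi (M * N)%g = chi M * chi N. Proof. exact: hchi.2. Qed.

Lemma linear_character_neq0 M : chi M != 0.
Proof. by rewrite -normr_eq0 hchi.1 oner_eq0. Qed.

Lemma linear_character1 : chi 1%g = 1.
Proof. by apply: (mulfI (linear_character_neq0 1%g)); rewrite -chiM mulg1 mulr1. Qed.

Lemma character_congr M N : (forall i j, M i j - N i j \in I) -> chi M = chi N.
Proof.
move=> h; suff e : chi (N^-1 * M)%g = 1.
  by rewrite -[M]mul1g -(mulgV N) -mulgA chiM e mulr1.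
apply: chiI => i j.
have -> : (N^-1 * M)%g i j - (1%:M : 'M_2) i j =
          N^-1%g i 0 * (M 0 j - N 0 j) + N^-1%g i 1 * (M 1 j - N 1 j).
  have -> : (1%:M : 'M_2) i j = (N^-1 * N)%g i j by rewrite mulVg.
  by rewrite !SL2_mulE; ring.
by apply: ideal_closedD => //; apply: ideal_closedM.
Qed.

Lemma character_congr2 M N :
  M 0 0 - N 0 0 \in I -> M 0 1 - N 0 1 \in I ->
  M 1 0 - N 1 0 \in I -> M 1 1 - N 1 1 \in I -> chi M = chi N.
Proof.
move=> *; apply: character_congr => i j.
by case: (ord2P i) (ord2P j) => -> [] ->.
Qed.

Definition psi x : R[i] := chi (upper x).

Lemma psiD x y : psi (x + y) = psi x * psi y.
Proof. by rewrite -chiM; congr chi; apply: SL2_eq; rewrite SL2_mulE !mxE /=; ring. Qed.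

Lemma psi0 : psi 0 = 1.
Proof.
rewrite -linear_character1; congr chi; apply: SL2_eq; rewrite !mxE //=.
Qed.

Lemma psiN x : psi (- x) = (psi x)^-1.
Proof.
apply: (mulfI (linear_character_neq0 (upper x))).
by rewrite -psiD subrr psi0 mulfV // linear_character_neq0.
Qed.

Lemma psi_ideal x : x \in I -> psi x = 1.
Proof.
move=> xI; rewrite -psi0; have I0 := ideal_closed0 hI.
by apply: character_congr2; rewrite !mxE /= ?subrr ?subr0.
Qed.

Fact weyl_subproof : 0 * 0 - 1 * (-1) = 1 :> o. Proof. ring. Qed.

Lemma chi_lower x : chi (lower x) = psi (- x).
Proof.
pose W := SL2_of weyl_subproof.
apply: (mulfI (linear_character_neq0 W)); rewrite -chiM mulrC -chiM; congr chi.
by apply: SL2_eq; rewrite !SL2_mulE !mxE /=; ring.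
Qed.

Fact hmat_subproof u v :
  (u + (1 - u * v) * u) * v - (- (1 - u * v)) * (1 - u * v) = 1.
Proof. ring. Qed.
(* A lift of diag(u, v) when v is inverse to u modulo the ideal. *)
Definition hmat u v : SL2 o := SL2_of (hmat_subproof u v).

(** Whitehead's factorisation. For v = 1/u the first three factors give the antidiagonal matrix with
    entries u and -1/u, and the last three are the inverse of the same product at u = v = 1. Lower
    factors enter [psi] with the opposite sign. *)
Lemma chi_hmat u v : chi (hmat u v) = psi (u + v + u - 3).
Proof.
have -> : hmat u v = (upper u * lower (- v) * upper u *
                      upper (- 1) * lower 1 * upper (- 1))%g.
  by apply: SL2_eq; rewrite !SL2_mulE !mxE /=; ring.
rewrite !chiM !chi_lower -![chi (upper _)]/(psi _) -!psiD; congr psi; ring.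
Qed.

Let tI t k : t \in I -> t * k \in I. Proof. exact: ideal_closedMr. Qed.

Lemma psi_sqr_unit u v x : 1 - u * v \in I -> psi ((u * u - 1) * x) = 1.
Proof.
move=> uvI; have e : chi (hmat u v * upper x)%g = chi (upper (u * u * x) * hmat u v)%g.
  have I0 := ideal_closed0 hI.
  apply: character_congr2; rewrite !SL2_mulE !mxE /=; set t := 1 - u * v in uvI *.
  - rewrite (_ : _ - _ = t * (- (u * u * x))); [exact: tI|by rewrite /t; ring].
  - rewrite (_ : _ - _ = t * (2 * u * x)); [exact: tI|by rewrite /t; ring].
  - by rewrite (_ : _ - _ = 0) //; ring.
  - rewrite (_ : _ - _ = t * x); [exact: tI|by rewrite /t; ring].
move: e; rewrite !chiM mulrC => /(mulIf (linear_character_neq0 _)) e.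
have -> : (u * u - 1) * x = u * u * x - x by ring.
by rewrite psiD psiN /psi -e mulfV // linear_character_neq0.
Qed.

(** At v = u the exponent 2u + v - 3 is 3u - 3, and [hmat u u] squares to the identity modulo the
    ideal. *)
Lemma psi_involution u : 1 - u * u \in I -> psi (6 * u - 6) = 1.
Proof.
move=> uuI; have : chi (hmat u u * hmat u u)%g = 1.
  rewrite -linear_character1; have I0 := ideal_closed0 hI.
  apply: character_congr2; rewrite !SL2_mulE !mxE /=; set t := 1 - u * u in uuI *.
  - rewrite (_ : _ - _ = t * (2 * u * u + t * u * u - t - 1)); [exact: tI|by rewrite /t; ring].
  - rewrite (_ : _ - _ = t * (- (2 * u + t * u))); [exact: tI|by rewrite /t; ring].
  - rewrite (_ : _ - _ = t * (2 * u + t * u)); [exact: tI|by rewrite /t; ring].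
  - rewrite (_ : _ - _ = t * (- t - 1)); [exact: tI|by rewrite /t; ring].
rewrite chiM !chi_hmat -psiD => <-; congr psi; ring.
Qed.

(* If the first row (a', b) of [M * lower x] starts with a unit a' modulo the   *)
(* ideal, then M * lower x is congruent to lower(c'/a') diag(a', 1/a') upper(b/a'). *)
Lemma chi_trivial_of_unit M x y : 1 - (M 0 0 + M 0 1 * x) * y \in I ->
  (forall z, psi z = 1) -> chi M = 1.
Proof.
move=> tIn psi1; pose a := M 0 0 + M 0 1 * x; pose b := M 0 1.
pose c := M 1 0 + M 1 1 * x; pose d := M 1 1.
have det : 1 + c * b - a * d = 0.
  by rewrite -[X in X + c * b](SL2_detE M) /a /b /c /d; ring.
have low z : chi (lower z) = 1 by rewrite chi_lower.
have e : chi (M * lower x)%g = chi (lower (c * y) * hmat a y * upper (y * b))%g.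
  have I0 := ideal_closed0 hI.
  have tI' k : (1 - a * y) * k \in I by exact: tI.
  apply/esym; apply: character_congr2; rewrite !SL2_mulE !mxE /=.
  - rewrite (_ : _ - _ = (1 - a * y) * a) //; rewrite /a; ring.
  - rewrite (_ : _ - _ = (1 - a * y) * (- b + a * y * b - 1)) //; rewrite /b; ring.
  - rewrite (_ : _ - _ = (1 - a * y) * (1 - c * (1 - a * y))) //; rewrite /c; ring.
  (* This entry is not a multiple of [t] by algebra alone: the remaining term carries the
     determinant relation, which vanishes. *)
  - set t := 1 - a * y; rewrite -/b -/d (_ : _ - _ =
      t * (- d - t * c * y * b - c * y + y * b) + y * (1 + c * b - a * d)).
      by rewrite det mulr0 addr0.
    by rewrite /t; ring.
move: e; rewrite !chiM chi_hmat -![chi (upper _)]/(psi _) !psi1 !low.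
by rewrite !mulr1.
Qed.

End CongruenceCharacters.

(** * Stable range: a character is determined by its values on elementary matrices *)

Section StableRange.
Variables (o : idomainType) (ho : dedekind_domain o).

(** Take x to be 1 at the primes containing a and 0 at the others. Where a is in p, b is not, since
    a d - b c = 1; so a + b x is a local unit everywhere, and the local inverses are glued by the
    idempotents. *)
Lemma stable_range (I : {pred o}) (a b c d : o) :
  ideal_closed I -> nonzero_ideal I -> a * d - b * c = 1 ->
  exists x y, 1 - (a + b * x) * y \in I.
Proof.
move=> hI I0 det; have [s [e [us eI eort esum eloc]]] := local_idempotents ho hI I0.
have ID := ideal_closedD hI; have IB := ideal_closedB hI.
have IM := ideal_closedM hI.
pose x := \sum_(p <- s | a \in p) e p.
have ex p : p \in s -> e p * x - e p * (a \in p)%:R \in I.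
  move=> ps; have [ap|ap] := boolP (a \in p).
    rewrite mulr1 /x (big_rem p) //= ap mulrDr.
    rewrite (_ : _ - _ = (e p * e p - e p) +
       e p * \sum_(q <- rem p s | a \in q) e q); last by ring.
    apply: ID; first exact: (eI p ps).2.
    rewrite mulr_sumr; apply: ideal_closed_sum => // q; rewrite mem_rem_uniq // inE.
    by move=> /andP[/eqP qp qs] _; apply: eort => // pq; apply: qp.
  rewrite mulr0 subr0 mulr_sumr; apply: ideal_closed_sum => // q qs aq.
  by apply: eort => // pq; rewrite pq aq in ap.
have exy p : exists y, p \in s -> e p * (1 - (a + b * x) * y) \in I.
  have [ps|ps] := boolP (p \in s); last by exists 0.
  have np : a + b * (a \in p)%:R \notin p.
    have [ap|ap] := boolP (a \in p); last by rewrite mulr0 addr0.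
    apply/negP => abp; suff : (1 : o) \in p by rewrite prime_ideal1.
    rewrite -det (_ : _ - _ = a * (d + c) - (a + b * 1) * c); last by ring.
    by apply: prime_idealB; apply: prime_idealMr.
  have [y yI] := eloc p _ ps np; exists y => _.
  rewrite (_ : _ * _ = e p * (1 - (a + b * (a \in p)%:R) * y) -
     b * y * (e p * x - e p * (a \in p)%:R)); last by ring.
  by apply: IB => //; apply: IM; exact: ex.
have [y yP] := choice exy.
exists x, (\sum_(p <- s) e p * y p).
set u := a + b * x.
rewrite (_ : _ - _ = (1 - \sum_(p <- s) e p) + \sum_(p <- s) e p * (1 - u * y p)).
  by apply: ID => //; apply: ideal_closed_sum => // p ps _; exact: yP.
rewrite mulr_sumr -addrA; congr (_ + _).
under [X in _ = - _ + X]eq_bigr => p _ do rewrite mulrBr mulr1 mulrCA.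
by rewrite sumrB addKr.
Qed.

Lemma sharp_trivial (R : realType) (chi : SL2 o -> R[i]) :
  SL2_sharp R o chi -> (forall x, psi chi x = 1) -> forall M, chi M = 1.
Proof.
move=> [hchi [_ [I [hI I0 chiI]]]] psi1 M.
have [x [y xyI]] := stable_range hI I0 (SL2_detE M).
exact: (chi_trivial_of_unit hchi hI chiI xyI psi1).
Qed.

End StableRange.

(** * The conductor of an additive character concentrated at one prime *)

Section LocalAdditiveCharacter.
Variables (o : idomainType) (ho : dedekind_domain o) (R : realType).
Variables (phi : o -> R[i]) (p : prime_ideal o).
Hypothesis phiD : forall x y, phi (x + y) = phi x * phi y.
Hypothesis phi0 : phi 0 = 1.
Hypothesis p0 : nonzero_ideal p.

(** For additive [phi] with phi 0 = 1 this is the largest ideal on which [phi] is trivial. *)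
Definition conductor : {pred o} := fun x => `[< forall y, phi (x * y) = 1 >].
Local Notation K := conductor.

Lemma conductorP x : reflect (forall y, phi (x * y) = 1) (x \in K).
Proof. exact: asboolP. Qed.

Hypothesis unitK : forall x, x \notin p -> exists y, 1 - x * y \in K.
Hypothesis sqrK : forall u, u \notin p -> u * u - 1 \in K.

Lemma conductor_closed : ideal_closed K.
Proof.
split; first by apply/conductorP => y; rewrite mul0r.
move=> a u v /conductorP uK /conductorP vK; apply/conductorP => y.
by rewrite mulrDl phiD vK mulr1 [a * u]mulrC -mulrA uK.
Qed.

Let KD := ideal_closedD conductor_closed.
Let KB := ideal_closedB conductor_closed.
Let KM := ideal_closedM conductor_closed.

Lemma phi_conductor x : x \in K -> phi x = 1.
Proof. by move=> /conductorP /(_ 1); rewrite mulr1. Qed.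

Lemma conductor_cancel x z : x \notin p -> x * z \in K -> z \in K.
Proof.
move=> /unitK[y yK] xz; have -> : z = z * (1 - x * y) + y * (x * z) by ring.
by apply: KD; apply: KM.
Qed.

Lemma local_trivial : ~ ring_isomorphic {ideal_quot p} 'F_2 ->
  ~ ring_isomorphic {ideal_quot p} 'F_3 -> forall x, phi x = 1.
Proof.
move=> n2 n3 x.
have [[u [up u2p]]|no] := pselect (exists u, u \notin p /\ u * u - 1 \notin p).
  have K1 : 1 \in K by apply: (conductor_cancel u2p); rewrite mulr1; exact: sqrK.
  by apply: phi_conductor; rewrite -[x]mulr1; exact: KM.
have [u up||] := residue_classification p0 => //.
by apply: contrapT => /negP u2p; apply: no; exists u.
Qed.

(** For x in p, (2 + x) x = (1 + x)^2 - 1 is in the conductor, and 2 + x can be cancelled because p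
    contains 3 and hence not 2. *)
Lemma local_F3 : ring_isomorphic {ideal_quot p} 'F_3 ->
  forall x, x \in p -> phi x = 1.
Proof.
move=> [g gb] x xp.
have p3 : (3 : o) \in p.
  apply/quot_map_eq0; apply: (bij_inj gb); rewrite rmorph0 !rmorph_nat.
  exact: val_inj.
have p2 : 2 \notin p.
  apply/negP => p2; have := prime_idealB p3 p2.
  have -> : 3 - 2 = 1 :> o by ring.
  by rewrite prime_ideal1.
apply: phi_conductor; apply: (@conductor_cancel (2 + x)).
  by apply/negP => h; have := prime_idealB h xp; rewrite addrK (negbTE p2).
have -> : (2 + x) * x = (1 + x) * (1 + x) - 1 by ring.
apply: sqrK; apply/negP => h; have := prime_idealB h xp.
by rewrite addrK prime_ideal1.
Qed.

Section ResidueF2.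
Hypothesis pF2 : ring_isomorphic {ideal_quot p} 'F_2.
Hypothesis phi12 : phi 12 = 1.

Lemma add1_notin (q : prime_ideal o) x : x \in q -> 1 + x \notin q.
Proof.
move=> xq; apply/negP => h; have := prime_idealB h xq.
by rewrite addrK prime_ideal1.
Qed.

Lemma sum_sq_phi : (forall x y, x \in p -> y \in p -> phi (x * y) = 1) ->
  forall x, x \in ideal_sq p -> phi x = 1.
Proof.
move=> h; apply: ideal_sq_ind => // x y ex ey.
by rewrite phiD ex ey mulr1.
Qed.

Lemma uniformizer_generates pi s : s \notin p ->
  (forall x, x \in p -> exists k, s * x = pi * k) ->
  forall x, x \in p -> exists k, x - pi * k \in K.
Proof.
move=> sp sP x xp; have [y yK] := unitK sp; have [k ek] := sP x xp.
exists (k * y); have -> : x - pi * (k * y) = x * (1 - s * y) + (s * x - pi * k) * y.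
  by ring.
by rewrite ek subrr mul0r addr0; exact: KM.
Qed.

(** Writing 2 as c pi^2 modulo the conductor turns (1 + pi)^2 - 1 into (1 + c pi) pi^2, whose first
    factor is a local unit. So pi^2 is in the conductor, and modulo the conductor it generates
    p^2. *)
Lemma local_F2_ramified : 2 \in ideal_sq p ->
  forall x, x \in ideal_sq p -> phi x = 1.
Proof.
move=> sq2; have [pi [pip _] [s sp sP]] := local_uniformizer_exists ho p0.
have gen := uniformizer_generates sp sP.
have mulK x y : x \in p -> y \in p -> exists k, x * y - pi * pi * k \in K.
  move=> /gen[k kK] /gen[l lK]; exists (k * l).
  have -> : x * y - pi * pi * (k * l) = y * (x - pi * k) + (pi * k) * (y - pi * l).
    by ring.
  by apply: KD; apply: KM.
have [c cK] : exists c, 2 - pi * pi * c \in K.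
  move: 2 sq2; apply: ideal_sq_ind => //.
    by exists 0; rewrite mulr0 subr0; exact: ideal_closed0 conductor_closed.
  move=> x y [k kK] [l lK]; exists (k + l).
  have -> : x + y - pi * pi * (k + l) = (x - pi * pi * k) + (y - pi * pi * l) by ring.
  exact: KD.
have pi2K : pi * pi \in K.
  apply: (@conductor_cancel (1 + c * pi)); first exact/add1_notin/prime_idealMl.
  have -> : (1 + c * pi) * (pi * pi) =
    ((1 + pi) * (1 + pi) - 1) - pi * (2 - pi * pi * c) by ring.
  by apply: KB; [apply: sqrK; exact: add1_notin|exact: KM].
apply: sum_sq_phi => x y xp yp; have [k kK] := mulK x y xp yp.
apply: phi_conductor; have -> : x * y = (x * y - pi * pi * k) + k * (pi * pi) by ring.
by apply: KD => //; exact: KM.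
Qed.

(** Here 2 is a uniformizer. For a in p, (1 + 2a)^2 - 1 = 4a (1 + a) puts 4a into the conductor.
    Modulo such elements a product of two elements of p is 0 or 4, the residue field being F_2, so
    only phi 4 = 1 remains. *)
Lemma local_F2_unramified : 2 \notin ideal_sq p ->
  forall x, x \in ideal_sq p -> phi x = 1.
Proof.
move=> n2; have [p2 F2] := residue_F2 pF2.
have [s sp sP] := local_uniformizer_sq ho p0 p2 n2.
have gen := uniformizer_generates sp sP.
have K4 a : a \in p -> 4 * a \in K.
  move=> ap; apply: (@conductor_cancel (1 + a)); first exact: add1_notin.
  have -> : (1 + a) * (4 * a) = (1 + 2 * a) * (1 + 2 * a) - 1 by ring.
  by apply: sqrK; apply: add1_notin; exact: prime_idealMr.
(* 12 = 8 + 4, and 8 = 4 * 2 is already in the conductor. *)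
have phi4 : phi 4 = 1.
  have := phi12; have -> : 12 = 4 * 2 + 4 :> o by ring.
  by rewrite phiD (phi_conductor (K4 2 p2)) mul1r.
apply: sum_sq_phi => x y /gen[k kK] /gen[l lK].
have e : x * y - 4 * (k * l) \in K.
  have -> : x * y - 4 * (k * l) = y * (x - 2 * k) + (2 * k) * (y - 2 * l) by ring.
  by apply: KD; apply: KM.
have -> : x * y = (x * y - 4 * (k * l)) + 4 * (k * l) by ring.
rewrite phiD (phi_conductor e) mul1r.
have [klp|klp] := F2 (k * l); first by apply: phi_conductor; exact: K4.
have -> : 4 * (k * l) = 4 + - (4 * (1 - k * l)) by ring.
rewrite phiD phi4 mul1r; apply: phi_conductor.
by apply: ideal_closedN; [exact: conductor_closed|exact: K4].
Qed.

Lemma local_F2 x : x \in ideal_sq p -> phi x = 1.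
Proof.
have [sq2|sq2] := boolP ((2 : o) \in ideal_sq p).
  exact: local_F2_ramified.
exact: local_F2_unramified.
Qed.

End ResidueF2.

End LocalAdditiveCharacter.

(** * The direct product decomposition *)

Section FiniteSupportProducts.
Variables (C : comPzRingType) (T : choiceType).
Implicit Types (h : T -> C) (s : seq T).

Lemma fsprod_seq h s : uniq s -> (forall i, i \notin s -> h i = 1) ->
  \big[*%R/1]_(i \in [set: T]) h i = \prod_(i <- s) h i.
Proof.
move=> us hs; rewrite (@fsbigE _ _ _ _ _ s h us) //; last by move=> i _; exact: hs.
by apply: eq_bigl => i; rewrite in_setT.
Qed.

Lemma finite_support_seq h : finite_set [set i | h i <> 1]%classic ->
  exists2 s, uniq s & forall i, i \notin s -> h i = 1.
Proof.
move=> /finite_seqP[s e]; exists (undup s); first exact: undup_uniq.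
move=> i; rewrite mem_undup => /negP si; apply: contrapT => hi; apply: si.
by have : [set i | h i <> 1]%classic i by []; rewrite e.
Qed.

Lemma seq_finite_support h s : (forall i, i \notin s -> h i = 1) ->
  finite_set [set i | h i <> 1]%classic.
Proof.
move=> hs; apply: (sub_finite_set _ (finite_seq s)) => i /= hi.
by apply: contrapT => /negP /hs.
Qed.

End FiniteSupportProducts.

(** * The group of characters with congruence kernel *)

Section SharpGroup.
Variables (R : realType) (o : idomainType).
Local Notation C := (SL2 o -> R[i]).
Implicit Types (chi : C) (I : {pred o}) (n : int).

Lemma sharpP chi : SL2_sharp R o chi <-> linear_character chi /\
  exists I, [/\ ideal_closed I, nonzero_ideal I &
    (principal_congruence I `<=` [set M | chi M = 1])%classic].
Proof.
split=> [[lc [_ h]]|[lc h]] //; split=> //; split=> //.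
split=> [|M N /= cM cN]; first exact: linear_character1.
have := lc.2 (M * N^-1)%g N; rewrite -mulgA mulVg mulg1 cM cN mulr1.
by move/esym.
Qed.

Lemma sharp1 : SL2_sharp R o 1.
Proof.
apply/sharpP; split; first by split=> *; rewrite ?normr1 ?mulr1.
exists (fun=> true); split=> //; exists 1 => //; exact: oner_neq0.
Qed.

Lemma sharpM chi1 chi2 : SL2_sharp R o chi1 -> SL2_sharp R o chi2 ->
  SL2_sharp R o (chi1 * chi2).
Proof.
move=> /sharpP[l1 [I1 [h1 [x x0 xI] k1]]] /sharpP[l2 [I2 [h2 [y y0 yI] k2]]].
apply/sharpP; split.
  split=> [M|M N]; rewrite /= ?mulrfctE ?normrM ?l1.1 ?l2.1 ?mulr1 //.
  by rewrite l1.2 l2.2 mulrACA.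
exists (fun z => (z \in I1) && (z \in I2)); split.
- split; first by apply/andP; split; exact: ideal_closed0.
  move=> a u v /andP[u1 u2] /andP[v1 v2].
  by apply/andP; split; [exact: h1.2|exact: h2.2].
- exists (x * y); first by rewrite mulf_neq0.
  by apply/andP; split; [exact: ideal_closedMr|exact: ideal_closedM].
- move=> M MI; rewrite /= mulrfctE k1 ?k2 ?mulr1 // => i j.
    by have /andP[] := MI i j.
  by have /andP[] := MI i j.
Qed.

Lemma sharpX chi n : SL2_sharp R o chi -> SL2_sharp R o (fun M => chi M ^ n).
Proof.
move=> /sharpP[l [I [hI I0 k]]]; apply/sharpP; split.
  split=> [M|M N]; last by rewrite l.2 expfzMl.
  by case: n => n; rewrite ?NegzE -?exprnN -?exprnP ?normfV normrX l.1 expr1n ?invr1.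
by exists I; split=> // M MI; rewrite /= k // exp1rz.
Qed.

Lemma sharp_prod (T : eqType) (s : seq T) (h : T -> C) :
  (forall i, i \in s -> SL2_sharp R o (h i)) -> SL2_sharp R o (\prod_(i <- s) h i).
Proof.
by move=> hs; rewrite big_seq; elim/big_ind: _ => //; [exact: sharp1|exact: sharpM].
Qed.

(** The quotient of the two characters has trivial [psi], hence is trivial. *)
Lemma sharp_inj chi1 chi2 : dedekind_domain o -> SL2_sharp R o chi1 ->
  SL2_sharp R o chi2 -> psi chi1 =1 psi chi2 -> chi1 = chi2.
Proof.
move=> ho s1 s2 e; have s3 := sharpM s1 (sharpX (-1) s2).
have n0 M : chi2 M != 0 by apply: linear_character_neq0; case: s2.
apply/funext => M; apply: (mulIf (invr_neq0 (n0 M))); rewrite mulfV //.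
apply: (sharp_trivial ho s3) => x.
by rewrite /psi mulrfctE -[chi1 _]/(psi chi1 x) e mulfV // n0.
Qed.

Lemma pullback_sharp (B : comNzRingType) m (f : {rmorphism o -> B})
    (k : SL2 B -> 'Z_m.+2) (I : {pred o}) : ideal_closed I -> nonzero_ideal I ->
  (forall x, x \in I -> f x = 0) -> (forall M N, k (M * N)%g = k M + k N) ->
  SL2_sharp R o (fun M => e_mod R m.+2 (k (SL2_map f M))).
Proof.
move=> hI I0 fI kM; apply/sharpP; split.
  split=> [M|M N]; first exact: e_mod_norm.
  by rewrite SL2_mapM kM e_modD.
exists I; split=> // M MI /=.
have -> : SL2_map f M = 1%g.
  apply: val_inj; apply/matrixP => i j; rewrite !mxE.
  apply/eqP; rewrite -subr_eq0; apply/eqP.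
  by have := fI _ (MI i j); rewrite rmorphB /= !mxE rmorph_nat.
have -> : k 1%g = 0 by apply: (addrI (k 1%g)); rewrite -kM mulg1 addr0.
exact: e_mod0.
Qed.

End SharpGroup.

(** * The additive characters of the listed factors *)

Section Factors.
Variables (R : realType) (o : idomainType) (ho : dedekind_domain o).
Implicit Types (p q r : prime_ideal o) (x y : o).

(** Common frame for the four families, each given by an additive exponent [k]: it yields membership
    in the group and the formula for [psi] from which generation and independence are proved. *)
Lemma pullback_desc (B : comNzRingType) m (eps : SL2 B -> R[i])
    (k : SL2 B -> 'Z_m.+2) (I : idealr o) :
  (forall M, eps M = e_mod R m.+2 (k M)) ->
  (forall M N, k (M * N)%g = k M + k N) ->
  nonzero_ideal I -> ring_isomorphic {ideal_quot I} B ->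
  exists f : {rmorphism o -> B}, [/\ forall z, exists x, f x = z,
    forall x, f x = 0 <-> x \in I, SL2_sharp R o (pullback eps I) &
    forall x, psi (pullback eps I) x = e_mod R m.+2 (k (upper (f x)))].
Proof.
move=> epsE kM I0 /(pullbackE eps)[f [fs f0 ->]]; exists f; split=> //.
  have -> : (fun M => eps (SL2_map f M)) = (fun M => e_mod R m.+2 (k (SL2_map f M))).
    by apply/funext => M; rewrite epsE.
  apply: (pullback_sharp _ (idealr_ideal_closed I)) => // x xI.
  exact/f0.
by move=> x; rewrite /psi epsE SL2_map_upper.
Qed.

Lemma nonzero_ideal_sq p : nonzero_ideal p -> nonzero_ideal (ideal_sq p).
Proof. by move=> [x x0 xp]; exists (x * x); rewrite ?mulf_neq0 ?mem_ideal_sq. Qed.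

Lemma factorP_desc p (H : ring_isomorphic {ideal_quot p} 'F_3) :
  exists f : {rmorphism o -> 'Z_3}, [/\ forall x, f x = 0 <-> x \in p,
    SL2_sharp R o (factor_character R (FactorP H)) &
    forall x, psi (factor_character R (FactorP H)) x = e_mod R 3 (f x)].
Proof.
have [f [_ f0 s e]] := pullback_desc (@eps3E R) kappa3M (residue_field_nonzero ho H) H.
by exists f; split=> // x; rewrite [LHS]e kappa3_upper.
Qed.

Lemma factorQ_desc q (H : ring_isomorphic {ideal_quot q} 'F_2)
    (n2 : ~ ideal_divides (ideal_sq q) 2) :
  exists f : {rmorphism o -> 'Z_4}, [/\ forall x, f x = 0 <-> x \in ideal_sq q,
    SL2_sharp R o (factor_character R (FactorQ H n2)) &
    forall x, psi (factor_character R (FactorQ H n2)) x = e_mod R 4 (f x)].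
Proof.
have q0 := residue_field_nonzero ho H.
have iso := quot_sq_Z4 ho q0 H (introN idP n2).
have [f [_ f0 s e]] := pullback_desc (@eps4E R) kappa4M (nonzero_ideal_sq q0) iso.
by exists f; split=> // x; rewrite [LHS]e kappa4_upper.
Qed.

Lemma factorR_desc r (H : ring_isomorphic {ideal_quot r} 'F_2)
    (h2 : ideal_divides (ideal_sq r) 2) :
  exists f : {rmorphism o -> 'Z_2}, [/\ forall x, f x = 0 <-> x \in r,
    SL2_sharp R o (factor_character R (FactorR H h2)) &
    forall x, psi (factor_character R (FactorR H h2)) x = e_mod R 2 (f x)].
Proof.
have [f [_ f0 s e]] := pullback_desc (@eps2E R) kappa2M (residue_field_nonzero ho H) H.
by exists f; split=> // x; rewrite [LHS]e kappa2_upper.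
Qed.

Lemma factorR'_desc r (H : ring_isomorphic {ideal_quot r} 'F_2)
    (h2 : ideal_divides (ideal_sq r) 2) :
  exists f : {rmorphism o -> F2t2}, [/\ forall z, exists x, f x = z,
    forall x, f x = 0 <-> x \in ideal_sq r,
    SL2_sharp R o (factor_character R (FactorR' H h2)) &
    forall x, psi (factor_character R (FactorR' H h2)) x = e_mod R 2 (dig1 (f x))].
Proof.
have r0 := residue_field_nonzero ho H.
have iso := quot_sq_F2t2 ho r0 H h2.
have [f [fs f0 s e]] := pullback_desc (@eps4'E R) dual_kappaM (nonzero_ideal_sq r0) iso.
by exists f; split=> // x; rewrite [LHS]e dual_kappa_upper.
Qed.

Definition factor_prime (i : factor_index o) : prime_ideal o :=
  match i with
  | FactorP p _ => p | FactorQ q _ _ => q | FactorR r _ _ => r | FactorR' r _ _ => r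
  end.

Lemma factor_sharp i : SL2_sharp R o (factor_character R i).
Proof.
case: i => [p H|q H n2|r H h2|r H h2].
- by have [f []] := factorP_desc H.
- by have [f []] := factorQ_desc H n2.
- by have [f []] := factorR_desc H h2.
- by have [f []] := factorR'_desc H h2.
Qed.

(** The modulus p^2 serves all four families at once, so that a single congruence argument can
    isolate the factors at one prime. *)
Lemma factor_sq_trivial i x : x \in ideal_sq (factor_prime i) ->
  psi (factor_character R i) x = 1.
Proof.
case: i => [p H|q H n2|r H h2|r H h2] xI.
- have [f [f0 _ ->]] := factorP_desc H.
  by rewrite (f0 x).2 ?e_mod0 //; exact: sub_ideal_sq.
- have [f [f0 _ ->]] := factorQ_desc H n2.
  by rewrite (f0 x).2 ?e_mod0.
- have [f [f0 _ ->]] := factorR_desc H h2.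
  by rewrite (f0 x).2 ?e_mod0 //; exact: sub_ideal_sq.
- have [f [_ f0 _ ->]] := factorR'_desc H h2.
  by rewrite (f0 x).2 // [dig1 0]dig1C (e_mod0 R 0).
Qed.

Lemma factor_prime_nonzero i : nonzero_ideal (factor_prime i).
Proof.
by case: i => [p H|q H n2|r H h2|r H h2]; exact: (residue_field_nonzero ho H).
Qed.

Lemma F2_F3_exclusive p : ring_isomorphic {ideal_quot p} 'F_2 ->
  ~ ring_isomorphic {ideal_quot p} 'F_3.
Proof.
move=> /residue_F2[p2 _] [g gb].
have p3 : (3 : o) \in p.
  apply/quot_map_eq0; apply: (bij_inj gb); rewrite rmorph0 !rmorph_nat.
  exact: val_inj.
have := prime_idealB p3 p2; have -> : 3 - 2 = 1 :> o by ring.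
by rewrite prime_ideal1.
Qed.

(** The defining conditions of the families exclude each other, except for the two indices at a
    prime r with r^2 dividing 2; within a family, proof irrelevance identifies indices with equal
    primes. *)
Lemma factor_same_prime (i j : factor_index o) :
  factor_prime i = factor_prime j -> i <> j ->
  (exists r H h2, i = @FactorR _ r H h2 /\ j = @FactorR' _ r H h2) \/
  (exists r H h2, i = @FactorR' _ r H h2 /\ j = @FactorR _ r H h2).
Proof.
case: i => [p H|q H n2|r H h2|r H h2]; case: j => [p' H'|q' H' n2'|r' H' h2'|r' H' h2'] /= e;
  subst; rewrite ?(Prop_irrelevance H' H) => ij //;
  try by [case: (F2_F3_exclusive H H')|case: (F2_F3_exclusive H' H)].
all: try by case: ij; congr FactorQ; exact: Prop_irrelevance.
all: try by case: ij; congr FactorR; exact: Prop_irrelevance.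
all: try by case: ij; congr FactorR'; exact: Prop_irrelevance.
- by left; exists r', H, h2; split=> //; congr FactorR'; exact: Prop_irrelevance.
- by right; exists r', H, h2; split=> //; congr FactorR; exact: Prop_irrelevance.
Qed.

End Factors.

(** * Generation and independence *)

Section Decomposition.
Variables (R : realType) (o : idomainType) (ho : dedekind_domain o).
Local Notation C := (SL2 o -> R[i]).
Local Notation T := {classic factor_index o}.
Local Notation eps i := (factor_character R (i : factor_index o)).
Implicit Types (p : prime_ideal o) (x y : o) (h : T -> C).

Lemma cyclic_subgroup1 (chi : C) : cyclic_subgroup chi 1.
Proof. by exists 0; apply/funext => M; rewrite expr0z. Qed.

Lemma cyclic_subgroup_sharp i (chi : C) : cyclic_subgroup (eps i) chi -> SL2_sharp R o chi.
Proof. by move=> [n ->]; apply: sharpX; exact: factor_sharp. Qed.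

Definition factor_family h : Prop :=
  (forall i, cyclic_subgroup (eps i) (h i)) /\
  finite_set [set i | h i <> 1]%classic.

Definition family_prod h : C := \big[*%R/1]_(i \in [set: T]) h i.

Definition generated (g : C) : Prop :=
  exists2 h, factor_family h & family_prod h = g.

Lemma family_prod_sharp h : factor_family h -> SL2_sharp R o (family_prod h).
Proof.
move=> [hc /finite_support_seq[s us hs]]; rewrite /family_prod (fsprod_seq us hs).
by apply: sharp_prod => i _; exact: cyclic_subgroup_sharp.
Qed.

Lemma generated1 : generated 1.
Proof.
exists (fun=> 1); last by rewrite /family_prod (@fsprod_seq _ _ _ [::]) ?big_nil.
split=> [i|]; first exact: cyclic_subgroup1.
exact: (@seq_finite_support _ _ _ [::]).
Qed.

Lemma generatedM g1 g2 : generated g1 -> generated g2 -> generated (g1 * g2).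
Proof.
move=> [h1 [c1 /finite_support_seq[s1 us1 hs1]] <-].
move=> [h2 [c2 /finite_support_seq[s2 us2 hs2]] <-].
have notin i : i \notin undup (s1 ++ s2) -> h1 i = 1 /\ h2 i = 1.
  by rewrite mem_undup mem_cat negb_or => /andP[/hs1 -> /hs2 ->].
have us := undup_uniq (s1 ++ s2).
exists (fun i => h1 i * h2 i).
  split; last first.
    by apply: (@seq_finite_support _ _ _ (undup (s1 ++ s2))) => i /notin[-> ->]; rewrite mulr1.
  move=> i; have [n1 e1] := c1 i; have [n2 e2] := c2 i; exists (n1 + n2).
  rewrite e1 e2; apply/funext => M; rewrite mulrfctE expfzDr //.
  by apply: linear_character_neq0; case: (factor_sharp R ho i).
rewrite /family_prod !(fsprod_seq us); first by rewrite big_split.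
- by move=> i /notin[].
- by move=> i /notin[].
- by move=> i /notin[-> ->]; rewrite mulr1.
Qed.

Lemma generated_prod (J : eqType) (s : seq J) (g : J -> C) :
  (forall j, j \in s -> generated (g j)) -> generated (\prod_(j <- s) g j).
Proof.
by move=> gs; rewrite big_seq; elim/big_ind: _ => //; [exact: generated1|exact: generatedM].
Qed.

Lemma generatedX i (n : nat) : generated (fun M => eps i M ^+ n).
Proof.
exists (fun j : T => if j == i then fun M => eps i M ^+ n else 1).
  split; last first.
    apply: (@seq_finite_support _ _ _ [:: (i : T)]) => j.
    by rewrite inE => /negbTE ->.
  move=> j; case: eqP => [->|_]; last exact: cyclic_subgroup1.
  by exists n%:Z; apply/funext => M; rewrite exprnP.
rewrite /family_prod (@fsprod_seq _ _ _ [:: (i : T)]) ?big_seq1 ?eqxx //.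
by move=> j; rewrite inE => /negbTE ->.
Qed.

(** Modulo the kernel of [f] every x is a multiple of 1, so phi is determined by phi 1, which is a
    root of unity of order dividing m + 2. *)
Lemma additive_power m (f : {rmorphism o -> 'Z_m.+2}) (phi : o -> R[i]) :
  (forall x y, phi (x + y) = phi x * phi y) -> phi 0 = 1 ->
  (forall x, f x = 0 -> phi x = 1) ->
  exists j : nat, forall x, phi x = e_mod R m.+2 (f x) ^+ j.
Proof.
move=> phiD phi0 fphi.
have phiMn k : phi k%:R = phi 1 ^+ k.
  by elim: k => [|k IH] //; rewrite -natr1 phiD IH exprSr.
have [j ej] : exists j, phi 1 = e_mod R m.+2 1 ^+ j.
  by apply: unity_e_mod; rewrite -phiMn fphi // rmorph_nat pchar_Zp.
exists j => x; have -> : x = (x - (f x : nat)%:R) + (f x : nat)%:R by rewrite subrK.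
rewrite phiD fphi ?mul1r; last by rewrite rmorphB rmorph_nat natr_Zp subrr.
rewrite phiMn ej rmorphD rmorphB rmorph_nat natr_Zp subrr add0r.
by rewrite [in RHS]e_mod_exp -!exprM mulnC.
Qed.

Section LocalComponent.
Variables (p : prime_ideal o) (phi : o -> R[i]).
Hypothesis p0 : nonzero_ideal p.
Hypothesis phiD : forall x y, phi (x + y) = phi x * phi y.
Hypothesis phi0 : phi 0 = 1.
Hypothesis unitK : forall x, x \notin p -> exists y, 1 - x * y \in conductor phi.
Hypothesis sqrK : forall u, u \notin p -> u * u - 1 \in conductor phi.
Hypothesis phi12 : phi 12 = 1.

Lemma local_component : exists2 g, generated g & psi g =1 phi.
Proof.
have [F2|n2] := pselect (ring_isomorphic {ideal_quot p} 'F_2); last first.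
  have [F3|n3] := pselect (ring_isomorphic {ideal_quot p} 'F_3); last first.
    exists 1; first exact: generated1.
    by move=> x; rewrite (local_trivial phiD phi0 p0 unitK sqrK n2 n3).
  have triv := local_F3 phiD phi0 unitK sqrK F3.
  have [f [f0 _ fE]] := factorP_desc R ho F3.
  have [j jP] := additive_power phiD phi0 (fun x => triv x \o (f0 x).1).
  exists (fun M => factor_character R (FactorP F3) M ^+ j); first exact: generatedX.
  by move=> x; rewrite jP -fE.
have triv := local_F2 ho phiD phi0 p0 unitK sqrK F2 phi12.
have [sq2|nsq2] := pselect (ideal_divides (ideal_sq p) 2); last first.
  have [f [f0 _ fE]] := factorQ_desc R ho F2 nsq2.
  have [j jP] := additive_power phiD phi0 (fun x => triv x \o (f0 x).1).
  exists (fun M => factor_character R (FactorQ F2 nsq2) M ^+ j); first exact: generatedX.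
  by move=> x; rewrite jP -fE.
have [f [f0 _ fE]] := factorR_desc R ho F2 sq2.
have [f' [fs' f0' _ fE']] := factorR'_desc R ho F2 sq2.
have [pi pialpha] := fs' alpha.
have root2 z : phi (z + z) = 1 -> exists j, phi z = e_mod R 2 1 ^+ j.
  by move=> e; apply: unity_e_mod; rewrite expr2 -phiD.
(* As 2 is in r^2, o/r^2 is additively a sum of two groups of order 2, generated by 1 and a lift
   [pi] of [alpha]; the signs phi 1 and phi pi give the exponents [a] and [b]. *)
have dbl z : phi (z + z) = 1.
  apply: triv; rewrite -[z]mul1r -mulrDl; exact: (ideal_closedMr (ideal_sq_closed p)).
have [a aP] := root2 1 (dbl 1); have [b bP] := root2 pi (dbl pi).
have pip : pi \in p.
  have : pi * pi \in ideal_sq p.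
    apply/f0'; rewrite rmorphM pialpha.
    by apply: F2t2_eq; rewrite ?dig0M ?dig1M dig0_alpha ?dig1_alpha
      ?[dig0 0]dig0C ?[dig1 0]dig1C ?mul0r ?mulr0 ?addr0.
  by move/sub_ideal_sq; rewrite prime_idealM orbb.
exists ((fun M => factor_character R (FactorR F2 sq2) M ^+ a) *
        (fun M => factor_character R (FactorR' F2 sq2) M ^+ b)).
  by apply: generatedM; exact: generatedX.
move=> x; rewrite /psi mulrfctE -![factor_character _ _ _]/(psi _ x) fE fE'.
have nat0 (c : 'F_2) : dig0 (c : nat)%:R = c /\ dig1 (c : nat)%:R = 0.
  case: c => [[|[|//]] ?] /=; split; apply: val_inj.
  - by rewrite [dig0 _]dig0C.
  - by rewrite [dig1 _]dig1C.
  - by rewrite [dig0 _]dig0_1.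
  - by rewrite [dig1 _]dig1_1.
pose d0 := dig0 (f' x); pose d1 := dig1 (f' x).
have xsq : x - ((d0 : nat)%:R + (d1 : nat)%:R * pi) \in ideal_sq p.
  apply/f0'; rewrite rmorphB rmorphD rmorphM !rmorph_nat pialpha.
  apply/eqP; rewrite subr_eq0; apply/eqP; apply: F2t2_eq.
    by rewrite dig0D dig0M dig0_alpha mulr0 addr0 (nat0 _).1.
  by rewrite dig1D dig1M dig0_alpha dig1_alpha mulr0 addr0 mulr1 (nat0 _).1 (nat0 _).2 add0r.
(* [f] and [f'] come from separate isomorphisms; they are linked because the class modulo r is the
   first digit modulo r^2. *)
have fx : f x = d0.
  have /f0 : x - ((d0 : nat)%:R + (d1 : nat)%:R * pi) \in p by exact: sub_ideal_sq.
  rewrite rmorphB rmorphD rmorphM (f0 pi).2 // mulr0 addr0 rmorph_nat natr_Zp.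
  by move/eqP; rewrite subr_eq0 => /eqP.
have phid (d : 'F_2) z c : phi z = e_mod R 2 1 ^+ c ->
    phi ((d : nat)%:R * z) = e_mod R 2 d ^+ c.
  case: d => [[|[|//]] lt2] /= zc.
    by rewrite mul0r phi0 (_ : Ordinal lt2 = 0) ?(e_mod0 R 0) ?expr1n //; exact: val_inj.
  by rewrite mul1r zc; congr (e_mod _ _ _ ^+ _); exact: val_inj.
have -> : x = (x - ((d0 : nat)%:R + (d1 : nat)%:R * pi)) +
   ((d0 : nat)%:R * 1 + (d1 : nat)%:R * pi) by rewrite mulr1 subrK.
by rewrite phiD (triv _ xsq) mul1r phiD !(phid _ _ _ aP) !(phid _ _ _ bP) mulr1 subrK fx.
Qed.

End LocalComponent.

Lemma sharp_generated chi : SL2_sharp R o chi -> generated chi.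
Proof.
move=> shchi; have /sharpP[lc [I [hI I0 chiI]]] := shchi.
have [s [e [us eI eort esum eloc]]] := local_idempotents ho hI I0.
have psiI := psi_ideal lc hI chiI.
have ID := ideal_closedD hI; have IB := ideal_closedB hI; have IM := ideal_closedM hI.
have psieq x y : x - y \in I -> psi chi x = psi chi y.
  by move=> h; rewrite -[x](subrK y) (psiD lc) psiI // mul1r.
have exg p : exists g, p \in s -> generated g /\ forall x, psi g x = psi chi (e p * x).
  have [ps|ps] := boolP (p \in s); last by exists 1.
  have [p0 epI] := eI p ps.
  suff [g gg ge] : exists2 g, generated g & psi g =1 (fun x => psi chi (e p * x)).
    by exists g.
  apply: (@local_component p) => //.
  - by move=> x y; rewrite mulrDr (psiD lc).
  - by rewrite mulr0 (psi0 lc).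
  - move=> x xp; have [y yI] := eloc p x ps xp; exists y.
    by apply/conductorP => z; apply: psiI; rewrite mulrA; exact: ideal_closedMr.
  - move=> u up; have [v vI] := eloc p u ps up; apply/conductorP => z.
    (* A global unit modulo [I] that is u at p and 1 at the other primes; w^2 - 1 is congruent to e
       p * (u^2 - 1). *)
    pose w := e p * u + (1 - e p); pose w' := e p * v + (1 - e p).
    have wI : 1 - w * w' \in I.
      rewrite (_ : _ - _ = e p * (1 - u * v) + (u + v - u * v - 1) * (e p * e p - e p));
        last by rewrite /w /w'; ring.
      by apply: ID => //; exact: IM.
    rewrite -(psi_sqr_unit lc hI chiI z wI); apply: psieq.
    rewrite (_ : _ - _ = - ((u * u - 2 * u + 1) * z) * (e p * e p - e p));
      last by rewrite /w; ring.
    exact: IM.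
  - have uI : 1 - (1 - 2 * e p) * (1 - 2 * e p) \in I.
      by rewrite (_ : _ - _ = - 4 * (e p * e p - e p)); [exact: IM|ring].
    have := psi_involution lc hI chiI uI.
    rewrite (_ : 6 * _ - 6 = - (e p * 12)); last by ring.
    by rewrite (psiN lc) => /(congr1 GRing.inv); rewrite invrK invr1.
have [g gP] := choice exg.
have -> : chi = \prod_(p <- s) g p.
  have gsharp p : p \in s -> SL2_sharp R o (g p).
    by move=> /gP[[h hf <-] _]; exact: family_prod_sharp.
  apply: (sharp_inj ho shchi (sharp_prod gsharp)) => x.
  rewrite /psi fct_prodE -![chi (upper x)]/(psi chi x).
  transitivity (psi chi ((\sum_(p <- s) e p) * x)).
    apply: psieq; rewrite -[X in X - _]mul1r -mulrBl; exact: ideal_closedMr.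
  rewrite mulr_suml (big_morph _ (psiD lc) (psi0 lc)).
  by apply: eq_big_seq => p /gP[_ <-].
by apply: generated_prod => p /gP[].
Qed.

(** The quotients [d i] of the two families have product 1. It suffices that each has trivial [psi],
    which is tested one prime at a time. *)
Lemma family_prod_inj h h' : factor_family h -> factor_family h' ->
  family_prod h = family_prod h' -> h = h'.
Proof.
move=> [hc /finite_support_seq[s1 us1 hs1]] [hc' /finite_support_seq[s2 us2 hs2]].
pose s := undup (s1 ++ s2); have us : uniq s := undup_uniq _.
have notin i : i \notin s -> h i = 1 /\ h' i = 1.
  by rewrite mem_undup mem_cat negb_or => /andP[/hs1 -> /hs2 ->].
rewrite /family_prod !(fsprod_seq us); try by move=> i /notin[].
move=> eprod.
have [n nP] := choice hc; have [n' nP'] := choice hc'.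
pose d i : C := fun M => eps i M ^ (n i - n' i).
have epsn0 i M : eps i M != 0.
  by apply: linear_character_neq0; case: (factor_sharp R ho i).
have dE i M : h i M = d i M * h' i M.
  by rewrite nP nP' /d -expfzDr // subrK.
have dsharp i : SL2_sharp R o (d i) by apply: sharpX; exact: factor_sharp.
have dlc i : linear_character (d i) by case: (dsharp i).
have h'n0 i M : h' i M != 0 by rewrite nP' expfz_neq0.
have d1 M : \prod_(i <- s) d i M = 1.
  have := congr1 (fun g => g M) eprod; rewrite !fct_prodE.
  under eq_bigr => i _ do rewrite dE.
  rewrite big_split /= -[RHS]mul1r => /mulIf; apply.
  by rewrite prodf_seq_neq0; apply/allP => i _; exact: h'n0.
have dsq i x : x \in ideal_sq (factor_prime i) -> psi (d i) x = 1.
  move=> xI; rewrite /psi /d -[eps i _]/(psi (eps i) x).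
  by rewrite factor_sq_trivial // exp1rz.
(* The relation is evaluated at an element congruent to x modulo the square of the prime of [i] and
   to 0 modulo the squares of the other primes occurring in [s]; only factors at the prime of [i]
   remain. *)
have local (i : T) x :
    (forall j : T, j <> i -> factor_prime j = factor_prime i -> psi (d j) x = 1) ->
    psi (d i) x = 1.
  move=> others; set p := factor_prime i in others.
  have [si|si] := boolP (i \in s); last first.
    have [e1 e2] := notin _ si.
    have := dE i (upper x); rewrite e1 e2 => di1.
    by rewrite -[LHS]mulr1; exact: esym di1.
  pose t := map (fun j : T => factor_prime j) s.
  have t0 q : q \in t -> nonzero_ideal q.
    by move=> /mapP[j _ ->]; exact: factor_prime_nonzero.
  have [f [fp fq]] := prime_ideal_crt ho (factor_prime_nonzero ho i) t0.
  (* This lifts the congruences of [f] from primes to their squares: 1 - c is divisible by (1 - f)^2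
     and c by f^2. *)
  pose c := 1 - (1 - f * f) * (1 - f * f).
  have cp : 1 - c \in ideal_sq p.
    have -> : 1 - c = ((1 - f) * (1 - f)) * ((1 + f) * (1 + f)) by rewrite /c; ring.
    by apply: (ideal_closedMr (ideal_sq_closed p)); exact: mem_ideal_sq.
  have cq j : j \in s -> factor_prime j <> p -> c \in ideal_sq (factor_prime j).
    move=> sj jp; have -> : c = (f * f) * (2 - f * f) by rewrite /c; ring.
    apply: (ideal_closedMr (ideal_sq_closed _)); apply: mem_ideal_sq;
      by apply: fq => //; exact: map_f.
  have := d1 (upper (c * x)); rewrite (bigD1_seq i) //= big_seq_cond big1 ?mulr1.
    move=> <-; rewrite -[d i _]/(psi (d i) _).
    rewrite -[x in LHS](subrK (c * x)) (psiD (dlc i)) dsq ?mul1r //.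
    have -> : x - c * x = (1 - c) * x by ring.
    exact: (ideal_closedMr (ideal_sq_closed _)).
  move=> j /andP[sj /eqP ji]; rewrite -[d j _]/(psi (d j) _).
  have [jp|jp] := pselect (factor_prime j = p); last first.
    by apply: dsq; apply: (ideal_closedMr (ideal_sq_closed _)); exact: cq.
  have -> : c * x = x + - ((1 - c) * x) by ring.
  rewrite (psiD (dlc j)) (psiN (dlc j)) [X in _ * X^-1]dsq ?invr1 ?mulr1; first exact: others.
  by rewrite jp; exact: (ideal_closedMr (ideal_sq_closed _)).
have dR (r : prime_ideal o) H m2 x : psi (d (@FactorR _ r H m2)) x = 1.
  have [f [f0 _ fE]] := factorR_desc R ho H m2.
  (* At 1 the factor modulo r^2 has exponent [dig1 1], which is 0, so the factor modulo r is left
     alone. Its additive character depends only on a residue in F_2, so its value at 1 decides. *)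
  have at1 : psi (d (@FactorR _ r H m2)) 1 = 1.
    apply: local => j ji jr.
    have [[r' [H' [m2' [je ie]]]]|[r' [H' [m2' [-> ie]]]]] := factor_same_prime jr ji.
      by rewrite je ie in ji.
    have [f' [_ _ _ fE']] := factorR'_desc R ho H' m2'.
    rewrite /psi /d -[factor_character _ _ _]/(psi _ 1) fE' rmorph1 dig1_1.
    by rewrite (e_mod0 R 0) exp1rz.
  rewrite -at1 /psi /d -![factor_character _ _ _]/(psi _ _) !fE rmorph1.
  have [x0|x1] : f x = 0 \/ f x = 1.
    by case: (f x) => [[|[|//]] ?]; [left|right]; exact: val_inj.
  - move: at1; rewrite /psi /d -![factor_character _ _ _]/(psi _ _) !fE rmorph1 => ->.
    by rewrite x0 (e_mod0 R 0) exp1rz.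
  - by rewrite x1.
(* With the factors modulo r known to be trivial, no other index at the same prime can interfere. *)
have dtriv (i : T) x : psi (d i) x = 1.
  have [[r [H [m2 ->]]]|nR] := pselect (exists r H m2, i = @FactorR _ r H m2).
    exact: dR.
  apply: local => j ji jr.
  have [[r [H [m2 [-> _]]]]|[r [H [m2 [_ ie]]]]] := factor_same_prime jr ji.
    exact: dR.
  by case: nR; exists r, H, m2.
apply/funext => i; apply/funext => M.
by rewrite dE (sharp_trivial ho (dsharp i) (dtriv i)) mul1r.
Qed.

End Decomposition.

Theorem theorem1 (R : realType) (o : idomainType) (ho : dedekind_domain o) :
  internal_direct_product (SL2_sharp R o)
    (fun i : {classic factor_index o} =>
       cyclic_subgroup (factor_character R i)).
Proof.
split=> [h hf|g /(sharp_generated ho)[h hf hg]]; first exact: family_prod_sharp.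
exists h; split=> // h' [hf' hg']; apply: (family_prod_inj ho hf hf').
by rewrite hg -hg'.
Qed.
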